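(* Let $q\in(0,1)$ and let $k\ge1$ be an integer. For the antipodal $\mathbb{Z}/2$-action on the quantum sphere $C(S^k_q)$, $$\mathrm{dim}^{\mathbb{Z}/2}_{\mathrm{WLT}}(C(S^k_q))=1.$$
   Context: For $n\ge1$ and $q\in(0,1)$, the Vaksman--Soibelman odd quantum sphere $C(S^{2n-1}_q)$ is the universal $C^*$-algebra generated by $z_1,\ldots,z_n$ subject to: $z_jz_i=q\,z_iz_j$ for $i<j$; $z_j^*z_i=q\,z_iz_j^*$ for $i\ne j$; $z_i^*z_i=z_iz_i^*+(1-q^2)\sum_{j>i}z_jz_j^*$ for all $i$; and $z_1z_1^*+\cdots+z_nz_n^*=1$. For $n\ge1$, the even quantum sphere $C(S^{2n}_q)$ is the quotient of $C(S^{2n+1}_q)$ by the relation $z_{n+1}=z_{n+1}^*$. The antipodal $\mathbb{Z}/2$-action is generated by $z_j\mapsto-z_j$ for all $j$. Weak local-triviality dimension: let a compact group $G$ act on a unital $C^*$-algebra $A$. Equip $C(G)$ with $(\alpha_gf)(h)=f(hg)$ and $C_0((0,1])\otimes C(G)$ with the action on the second factor, and let $t$ be the identity function in $C_0((0,1])$. $\mathrm{dim}^G_{\mathrm{WLT}}(A)$ is the smallest $m\ge0$ for which there exist $G$-equivariant $*$-homomorphisms $\rho_0,\ldots,\rho_m:C_0((0,1])\otimes C(G)\to A$ such that $\sum_{i=0}^m\rho_i(t\otimes1)$ is invertible ($\infty$ if no such $m$ exists). *)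

(* Defs.v *)
From HB Require Import structures.
From mathcomp Require Import all_boot all_order all_algebra all_fingroup.
From mathcomp Require Import complex.
From mathcomp Require Import all_classical all_reals all_analysis.

Set Implicit Arguments.
Unset Strict Implicit.
Unset Printing Implicit Defensive.

Import Order.TTheory GRing.Theory Num.Theory.
Import numFieldNormedType.Exports.

Local Open Scope classical_set_scope.
Local Open Scope complex_scope.
Local Open Scope ring_scope.

(* Unital complex C*-algebras. As [algType] is built on nontrivial rings, the
   zero algebra is excluded; it is a target of exactly one unital
   *-homomorphism from any algebra, so universal properties do not see it.
   The norm is a field of the structure because HB admits no common
   substructure of [algType] and [completeNormedModType] over the same type
   (their join is already taken by [numDomainType]). *)
HB.mixin Record isCStarAlgebra (R : realType) A of GRing.Algebra R[i] A := {
  star : A -> A;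
  starK : involutive star;
  starD : {morph star : x y / x + y};
  starZ : forall (a : R[i]) x, star (a *: x) = a^* *: star x;
  starM : forall x y, star (x * y) = star y * star x;
  cnorm : A -> R;
  cnorm_eq0 : forall x, cnorm x = 0 -> x = 0;
  cnormD : forall x y, cnorm (x + y) <= cnorm x + cnorm y;
  cnormZ : forall (a : R[i]) x, cnorm (a *: x) = complex.Re `|a| * cnorm x;
  cnormM : forall x y, cnorm (x * y) <= cnorm x * cnorm y;
  cnorm_starM : forall x, cnorm (star x * x) = cnorm x ^+ 2;
  cnorm_complete : forall u : nat -> A,
    (forall e, 0 < e -> \forall N \near \oo, forall m n,
       (N <= m)%N -> (N <= n)%N -> cnorm (u m - u n) < e) ->
    exists l, forall e, 0 < e -> \forall n \near \oo, cnorm (u n - l) < e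
}.

#[short(type="cstarAlgType")]
HB.structure Definition CStarAlgebra (R : realType) :=
  {A of GRing.Algebra R[i] A & isCStarAlgebra R A}.

Section CStarNotions.
Variables (R : realType) (A B : cstarAlgType R).

Record unital_star_hom (f : A -> B) : Prop := {
  star_hom_linear : linear f;
  star_hom1 : f 1 = 1;
  star_homM : {morph f : x y / x * y};
  star_homS : {morph f : x / star x}
}.

Definition invertible (x : A) : Prop := exists y, x * y = 1 /\ y * x = 1.

Record closed_ideal (I : set A) : Prop := {
  closed_ideal0 : I 0;
  closed_idealD : forall x y, I x -> I y -> I (x + y);
  closed_idealMl : forall a x, I x -> I (a * x);
  closed_idealMr : forall a x, I x -> I (x * a);
  closed_ideal_closed : forall x,
    (forall e, 0 < e -> exists2 y, I y & cnorm (x - y) < e) -> I x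
}.

(* [p] presents [B] as the quotient of [A] by the closed two-sided ideal
   generated by [S]. *)
Record quotient_by (S : set A) (p : A -> B) : Prop := {
  quotient_hom : unital_star_hom p;
  quotient_surj : forall y, exists x, p x = y;
  quotient_ker : [set x | p x = 0] = smallest closed_ideal S
}.

End CStarNotions.

Section QuantumSpheres.
Variables (R : realType) (q : R).

(* Generators are indexed from 0: [z i] is the generator $z_{i+1}$. *)
Record VS_relations (n : nat) (A : cstarAlgType R) (z : 'I_n -> A) : Prop := {
  VS_comm : forall i j : 'I_n, (i < j)%N -> z j * z i = q%:C *: (z i * z j);
  VS_star_comm : forall i j : 'I_n, i != j ->
    star (z j) * z i = q%:C *: (z i * star (z j));
  VS_normal : forall i : 'I_n,
    star (z i) * z i = z i * star (z i)
      + (1 - q ^+ 2)%:C *: \sum_(j < n | (i < j)%N) z j * star (z j);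
  VS_sphere : \sum_(i < n) z i * star (z i) = 1
}.

(* [A], with generators [z], is the universal C*-algebra for these relations:
   this is $C(S^{2n-1}_q)$. *)
Definition odd_qsphere (n : nat) (A : cstarAlgType R) (z : 'I_n -> A) : Prop :=
  VS_relations z /\
  forall (B : cstarAlgType R) (w : 'I_n -> B), VS_relations w ->
    exists! f : A -> B, unital_star_hom f /\ forall i, f (z i) = w i.

(* $C(S^{2n}_q)$ *)
Definition even_qsphere (n : nat) (A : cstarAlgType R) (z : 'I_n.+1 -> A)
    : Prop :=
  exists (B : cstarAlgType R) (w : 'I_n.+1 -> B) (p : B -> A),
    [/\ odd_qsphere w,
        quotient_by [set w ord_max - star (w ord_max)] p &
        forall i, p (w i) = z i].

(* $C(S^k_q)$ for k >= 1. Both $S^{2n-1}_q$ (n generators) and $S^{2n}_q$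
   (n+1 generators) have floor(k/2) + 1 generators. *)
Definition qsphere (k : nat) (A : cstarAlgType R) (z : 'I_k./2.+1 -> A)
    : Prop :=
  if odd k then odd_qsphere z else even_qsphere z.

End QuantumSpheres.

Section WLT.
Variables (R : realType) (G : finGroupType) (A : cstarAlgType R).

Record star_action (alpha : G -> A -> A) : Prop := {
  star_action_hom : forall g, unital_star_hom (alpha g);
  star_action1 : forall x, alpha 1%g x = x;
  star_actionM : forall g h x, alpha (g * h)%g x = alpha g (alpha h x)
}.

(* $C_0((0,1])$, each function being extended by 0 to the whole line.
   The cast gives [R[i]] its canonical topology. *)
Definition C0_01 : set (R -> R[i]) :=
  [set f | [/\ {within `]0, 1], continuous (f : R -> (R[i] : numClosedFieldType))},
               (f : R -> (R[i] : numClosedFieldType)) x @[x --> 0^'+] --> 0 &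
               forall x, x \notin `]0, 1] -> f x = 0]].

(* $C_0((0,1]) \otimes C(G)$. Since G is finite, $C(G)$ is the space of all
   functions on G and the tensor product consists of the families
   $(F_g)_{g \in G}$ in $C_0((0,1])$, with $f \otimes c$ = [fun g x => c g * f x]. *)
Definition C0_tensor_CG : set (G -> R -> R[i]) :=
  [set F | forall g, C0_01 (F g)].

(* [t] $\otimes$ 1 *)
Definition t_tensor_1 : G -> R -> R[i] :=
  fun _ x => if x \in `]0, 1] then x%:C else 0.

(* G-equivariant (non-unital) *-homomorphisms from $C_0((0,1]) \otimes C(G)$
   to A; the values of [rho] off [C0_tensor_CG] are irrelevant. *)
Record equivariant_star_hom (alpha : G -> A -> A)
    (rho : (G -> R -> R[i]) -> A) : Prop := {
  equiv_homD : forall F H, C0_tensor_CG F -> C0_tensor_CG H ->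
    rho (fun g x => F g x + H g x) = rho F + rho H;
  equiv_homZ : forall (a : R[i]) F, C0_tensor_CG F ->
    rho (fun g x => a * F g x) = a *: rho F;
  equiv_homM : forall F H, C0_tensor_CG F -> C0_tensor_CG H ->
    rho (fun g x => F g x * H g x) = rho F * rho H;
  equiv_homS : forall F, C0_tensor_CG F ->
    rho (fun g x => (F g x)^*) = star (rho F);
  equiv_homG : forall g F, C0_tensor_CG F ->
    rho (fun h => F (h * g)%g) = alpha g (rho F)
}.

Definition WLT_le (alpha : G -> A -> A) (m : nat) : Prop :=
  exists rho : 'I_m.+1 -> (G -> R -> R[i]) -> A,
    (forall i, equivariant_star_hom alpha (rho i)) /\
    invertible (\sum_(i < m.+1) rho i t_tensor_1).

Definition dim_WLT (alpha : G -> A -> A) : \bar R :=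
  if pselect (exists m, `[< WLT_le alpha m >]) is left ex
  then (ex_minn ex)%:R%:E else +oo%E.

End WLT.

(* [1 : 'Z_2] is the generator of the group of order 2, whose group law
   is addition. *)
Definition antipodal_action (R : realType) (A : cstarAlgType R) (n : nat)
    (z : 'I_n -> A) (alpha : 'Z_2 -> A -> A) : Prop :=
  star_action alpha /\ forall j, alpha 1 (z j) = - z j.

(* Main.v *)
(* Write z for the first generator. The sphere relation turns the first normality relation into
   z^* z = (1 - q^2) + q^2 z z^*. As the spectra of z z^* and z^* z agree off 0, iterating this
   affine map shows that z z^* has no negative spectrum, hence z z^* + z^* z is invertible. So
   a multiple of the sum of the squares of the real and imaginary parts x_0, x_1 of z is
   invertible; these are odd, and an odd self-adjoint contraction x yields, by functional
   calculus, an equivariant *-homomorphism sending t (x) 1 to |x|. Since |x_i| >= x_i^2, the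
   sum |x_0| + |x_1| is invertible and the dimension is at most 1.

   It is not 0: an equivariant *-homomorphism with rho(t (x) 1) invertible gives an odd
   self-adjoint x with x^2 invertible. Sending z to a point of the circle and the other
   generators to 0 maps x to a nowhere vanishing odd real function on the circle, against the
   intermediate value theorem.

   Positivity is expressed through norms, as |c - y| <= c. The bound |p(x)| <= sup |p| behind
   the functional calculus is obtained by writing x as the real part of a unitary u: then p(x)
   u^d is a polynomial in u, and its coefficients are bounded by a discrete Fourier transform.
   *)
Require Import Defs.
From HB Require Import structures.
From mathcomp Require Import all_boot all_order all_algebra all_fingroup.
From mathcomp Require Import complex.
From mathcomp Require Import all_classical all_reals all_analysis.
From mathcomp Require Import cyclic separable cyclotomic ring lra zify.

Set Implicit Arguments.
Unset Strict Implicit.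
Unset Printing Implicit Defensive.

Import Order.TTheory GRing.Theory Num.Theory.
Import numFieldNormedType.Exports.

Local Open Scope classical_set_scope.
Local Open Scope complex_scope.
Local Open Scope ring_scope.

(** * Norm and star in a C*-algebra *)

Section Cabs.
Variable R : realType.
Implicit Types a b : R[i].

Definition cabs a : R := complex.Re `|a|.

Lemma cabsE a : `|a| = (cabs a)%:C.
Proof. by rewrite /cabs normc_def. Qed.

Lemma cabs_ge0 a : 0 <= cabs a.
Proof. by rewrite /cabs normc_def sqrtr_ge0. Qed.

Lemma cabsD a b : cabs (a + b) <= cabs a + cabs b.
Proof. by rewrite -lecR rmorphD /= -!cabsE ler_normD. Qed.

Lemma cabsN a : cabs (- a) = cabs a.
Proof. by rewrite /cabs normrN. Qed.

Lemma cabsB a b : cabs (a - b) = cabs (b - a).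
Proof. by rewrite /cabs distrC. Qed.

Lemma cabsM a b : cabs (a * b) = cabs a * cabs b.
Proof. by apply: complexI; rewrite rmorphM /= -!cabsE normrM. Qed.

Lemma cabs_real (r : R) : cabs r%:C = `|r|.
Proof. by rewrite /cabs normc_def /= expr0n addr0 sqrtr_sqr. Qed.

Lemma cabs0 : cabs 0 = 0.
Proof. by rewrite /cabs normr0. Qed.

Lemma cabs1 : cabs 1 = 1.
Proof. by rewrite /cabs normr1. Qed.

Lemma cabsX a n : cabs (a ^+ n) = cabs a ^+ n.
Proof. by elim: n => [|n IH]; rewrite ?expr0 ?cabs1 // !exprS cabsM IH. Qed.

Lemma cabs_conj a : cabs a^* = cabs a.
Proof. by rewrite /cabs norm_conjC. Qed.

Lemma cabs_eq0 a : cabs a = 0 -> a = 0.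
Proof. by move=> h; apply/eqP; rewrite -normr_eq0 cabsE h. Qed.

Lemma cabs_nat n : cabs n%:R = n%:R.
Proof. by rewrite -(rmorph_nat (real_complex R)) cabs_real ger0_norm. Qed.

Lemma cabs_sum (I : Type) (r : seq I) (P : pred I) (F : I -> R[i]) :
  cabs (\sum_(i <- r | P i) F i) <= \sum_(i <- r | P i) cabs (F i).
Proof.
elim/big_rec2: _ => [|i x y _ h]; first by rewrite cabs0.
by apply: le_trans (cabsD _ _) _; rewrite lerD2l.
Qed.

Lemma conj_real (r : R) : (r%:C)^* = r%:C.
Proof. exact: conjc_real. Qed.

Lemma half_real : (2^-1 : R[i]) = (2^-1 : R)%:C.
Proof. by rewrite fmorphV rmorph_nat. Qed.

Lemma Re_le_cabs a : `|complex.Re a| <= cabs a.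
Proof. by rewrite -lecR -cabsE; apply: normc_ge_Re. Qed.

Lemma Im_le_cabs a : `|complex.Im a| <= cabs a.
Proof. by rewrite /cabs normc_def /= -sqrtr_sqr ler_wsqrtr // lerDr sqr_ge0. Qed.

Lemma cabs_le_ReIm a : cabs a <= `|complex.Re a| + `|complex.Im a|.
Proof.
case: a => x y; rewrite /cabs normc_def /= -[leRHS]ger0_norm ?addr_ge0 //.
rewrite -sqrtr_sqr ler_wsqrtr // sqrrD -(real_normK (num_real x)) -(real_normK (num_real y)) lerD2r lerDl.
by rewrite mulrn_wge0 // mulr_ge0.
Qed.

End Cabs.

Section CStarBasics.
Variables (R : realType) (A : cstarAlgType R).
Implicit Types (x y z : A) (a : R[i]) (r e : R).

Lemma cnormZc a x : cnorm (a *: x) = cabs a * cnorm x.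
Proof. exact: cnormZ. Qed.

Lemma cnorm0 : cnorm (0 : A) = 0.
Proof. by rewrite -(scale0r (0 : A)) cnormZc cabs0 mul0r. Qed.

Lemma cnormN x : cnorm (- x) = cnorm x.
Proof. by rewrite -scaleN1r cnormZc cabsN cabs1 mul1r. Qed.

Lemma cnorm_ge0 x : 0 <= cnorm x.
Proof.
have := cnormD x (- x); rewrite subrr cnorm0 cnormN -mulr2n.
by rewrite pmulrn_lge0.
Qed.

Lemma cnorm_distC x y : cnorm (x - y) = cnorm (y - x).
Proof. by rewrite -cnormN opprB. Qed.

Lemma cnormB x y : cnorm (x - y) <= cnorm x + cnorm y.
Proof. by rewrite -[cnorm y]cnormN cnormD. Qed.

(** The C*-identity and submultiplicativity bound [cnorm y ^+ 2] by [cnorm (star y) * cnorm y];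
    cancelling a factor gives one inequality, and [starK] the other. *)
Lemma cnorm_star x : cnorm (star x) = cnorm x.
Proof.
have le y : cnorm y <= cnorm (star y).
  have := cnormM (star y) y; rewrite cnorm_starM expr2.
  have [->|y0] := eqVneq (cnorm y) 0; first by rewrite cnorm_ge0.
  by rewrite ler_pM2r // lt0r y0 cnorm_ge0.
by apply/eqP; rewrite eq_le le andbT -[X in _ <= cnorm X]starK le.
Qed.

Lemma star1 : star (1 : A) = 1.
Proof. by rewrite -[LHS]mulr1 -[X in _ * X]starK -starM mulr1 starK. Qed.

Lemma cnorm1 : cnorm (1 : A) = 1.
Proof.
have := cnorm_starM (1 : A); rewrite star1 mulr1 expr2 => /esym/eqP.
rewrite -{3}[cnorm 1]mulr1 -subr_eq0 -mulrBr mulf_eq0 => /orP[/eqP/cnorm_eq0/eqP|].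
  by rewrite oner_eq0.
by rewrite subr_eq0 => /eqP.
Qed.

Lemma star0 : star (0 : A) = 0.
Proof. by apply: (addrI (star 0)); rewrite -starD !addr0. Qed.

Lemma starN x : star (- x) = - star x.
Proof. by apply/eqP; rewrite -addr_eq0 -starD addNr star0. Qed.

Lemma starB x y : star (x - y) = star x - star y.
Proof. by rewrite starD starN. Qed.

Lemma starZr r x : star (r%:C *: x) = r%:C *: star x.
Proof. by rewrite starZ conj_real. Qed.

Lemma starX x n : star (x ^+ n) = star x ^+ n.
Proof. by elim: n => [|n IH]; rewrite ?star1 // exprS starM IH exprSr. Qed.

Lemma cnormX x n : cnorm (x ^+ n) <= cnorm x ^+ n.
Proof.
elim: n => [|n IH]; first by rewrite !expr0 cnorm1.
by rewrite !exprS (le_trans (cnormM _ _)) // ler_wpM2l // cnorm_ge0.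
Qed.

Lemma cnorm_sum (I : Type) (s : seq I) (P : pred I) (F : I -> A) :
  cnorm (\sum_(i <- s | P i) F i) <= \sum_(i <- s | P i) cnorm (F i).
Proof.
elim/big_rec2: _ => [|i x y _ h]; first by rewrite cnorm0.
by apply: le_trans (cnormD _ _) _; rewrite lerD2l.
Qed.

Lemma cnorm_le_eps0 x : (forall e, 0 < e -> cnorm x <= e) -> x = 0.
Proof.
move=> h; apply: cnorm_eq0; apply/eqP; rewrite eq_le cnorm_ge0 andbT.
by apply/ler_addgt0Pr => e e0; rewrite add0r h.
Qed.

Lemma cnorm_sa_sqr x : star x = x -> cnorm (x ^+ 2) = cnorm x ^+ 2.
Proof. by move=> sx; rewrite -cnorm_starM sx expr2. Qed.

(** This exactness replaces the spectral radius formula: a bound on the powers that loses a factor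
    linear in the exponent still yields the sharp bound on [x]. *)
Lemma cnorm_sa_pow2 x k : star x = x -> cnorm (x ^+ (2 ^ k)) = cnorm x ^+ (2 ^ k).
Proof.
move=> sx; elim: k => [|k IH]; first by rewrite !expr1.
by rewrite expnSr !exprM cnorm_sa_sqr ?starX ?sx // IH.
Qed.

Lemma cnorm_unitary x : star x * x = 1 -> cnorm x = 1.
Proof.
move=> h; have := cnorm_starM x; rewrite h cnorm1 => /esym/eqP.
by rewrite sqrp_eq1 ?cnorm_ge0 // => /eqP.
Qed.

(** The completeness of [A] enters the proof only here. *)
Lemma cauchy_geometric (u : nat -> A) (c k : R) : 0 <= k -> k < 1 ->
  (forall n, cnorm (u n.+1 - u n) <= c * k ^+ n) ->
  exists l, forall e, 0 < e -> \forall n \near \oo, cnorm (u n - l) < e.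
Proof.
move=> k0 k1 h; apply: cnorm_complete => e e0.
have c0 : 0 <= c by have := le_trans (cnorm_ge0 _) (h 0%N); rewrite expr0 mulr1.
have k1' : 0 < 1 - k by rewrite subr_gt0.
(* The right-hand side is the closed form of the sum of c k^(N+j) over j < m. *)
have step N m : cnorm (u (N + m)%N - u N) <= c * k ^+ N * (1 - k)^-1 * (1 - k ^+ m).
  elim: m => [|m IH]; first by rewrite addn0 subrr cnorm0 expr0 subrr mulr0.
  rewrite -(subrKA (u (N + m)%N)) addnS.
  apply: le_trans (cnormD _ _) _; apply: le_trans (lerD (h _) IH) _.
  rewrite le_eqVlt; apply/orP; left; apply/eqP.
  by rewrite exprD exprS; field; rewrite gt_eqF.
have lim : (fun n => 2 * c * (1 - k)^-1 * k ^+ n) @ \oo --> 0.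
  rewrite -[X in _ --> X](mulr0 (2 * c * (1 - k)^-1)).
  by apply: cvgMl_tmp; apply: cvg_expr; rewrite ger0_norm.
have : \forall n \near \oo, 2 * c * (1 - k)^-1 * k ^+ n < e by exact: cvgr_lt lim _ e0.
apply: filterS => N hN m n Nm Nn; apply: le_lt_trans hN.
rewrite -(subrKA (u N)).
apply: le_trans (cnormD _ _) _; rewrite (cnorm_distC (u N)).
rewrite -{1}(subnKC Nm) -{1}(subnKC Nn).
have b j : c * k ^+ N * (1 - k)^-1 * (1 - k ^+ j) <= c * k ^+ N * (1 - k)^-1.
  rewrite ler_piMr //; last by rewrite gerBl exprn_ge0.
  by rewrite !mulr_ge0 ?exprn_ge0 // invr_ge0 ltW.
apply: le_trans (lerD (step _ _) (step _ _)) _.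
apply: le_trans (lerD (b _) (b _)) _.
by rewrite le_eqVlt; apply/orP; left; apply/eqP; ring.
Qed.

(** Banach's fixed point theorem on a closed set, iterating from 0. It produces both the inverses
    and the square roots below, in place of power series. *)
Lemma cnorm_fixpoint (K : set A) (f : A -> A) (k : R) : 0 <= k -> k < 1 ->
  K 0 -> (forall x, K x -> K (f x)) ->
  (forall x y, K x -> K y -> cnorm (f x - f y) <= k * cnorm (x - y)) ->
  (forall x, (forall e, 0 < e -> exists2 y, K y & cnorm (x - y) < e) -> K x) ->
  exists2 x, K x & f x = x.
Proof.
move=> k0 k1 K0 Kf lip clK; pose u n := iter n f 0.
have Ku n : K (u n) by elim: n => //= n; exact: Kf.
have [n|l hl] := @cauchy_geometric u (cnorm (u 1%N - u 0%N)) k k0 k1.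
  elim: n => [|n IH]; first by rewrite expr0 mulr1.
  apply: le_trans (lip (u n.+1) (u n) (Ku _) (Ku _)) _.
  by rewrite exprS mulrCA ler_wpM2l.
have Kl : K l.
  apply: clK => e e0; have [N _ hN] := hl e e0.
  by exists (u N) => //; rewrite cnorm_distC; apply: hN => /=.
exists l => //; apply/eqP; rewrite -subr_eq0; apply/eqP; apply: cnorm_le_eps0 => e e0.
have e2 : 0 < e / 2 by rewrite divr_gt0.
have [N _ hN] := hl _ e2.
rewrite -(subrKA (u N.+1)).
apply: le_trans (cnormD _ _) _; rewrite [leRHS]splitr lerD //; last first.
  by rewrite ltW // hN //=.
apply: le_trans (lip l (u N) Kl (Ku N)) _; rewrite cnorm_distC.
have /= hNN := hN N (leqnn N).
by apply: le_trans (ltW hNN); rewrite ler_piMl ?cnorm_ge0 // ltW.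
Qed.

End CStarBasics.

Section Zmod.
Variable V : zmodType.
Implicit Types x y z : V.

Lemma addrDB x y z : x + y - (x + z) = y - z.
Proof. by rewrite opprD addrACA subrr add0r. Qed.

End Zmod.

(** * Criteria for invertibility *)

Section Invertible.
Variables (R : realType) (A : cstarAlgType R).
Implicit Types (x y z : A) (a : R[i]).

(** A right inverse is a fixed point of v -> 1 + x v and a left one of w -> 1 + w x; both maps
    contract with ratio [cnorm x], and the two inverses coincide. *)
Lemma invertible_neumann x : cnorm x < 1 -> invertible (1 - x).
Proof.
move=> x1.
have [v _ hv] : exists2 v, [set: A] v & 1 + x * v = v.
  apply: (@cnorm_fixpoint R A setT (fun v => 1 + x * v) (cnorm x)) => //.
  - exact: cnorm_ge0.
  - by move=> y z _ _; rewrite addrDB -mulrBr cnormM.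
have [w _ hw] : exists2 w, [set: A] w & 1 + w * x = w.
  apply: (@cnorm_fixpoint R A setT (fun v => 1 + v * x) (cnorm x)) => //.
  - exact: cnorm_ge0.
  - by move=> y z _ _; rewrite addrDB -mulrBl mulrC cnormM.
have Ev : (1 - x) * v = 1 by rewrite mulrBl mul1r -{1}hv addrK.
have Ew : w * (1 - x) = 1 by rewrite mulrBr mulr1 -{1}hw addrK.
exists v; split => //.
by rewrite -[v]mul1r -{1}Ew -[w * _ * v]mulrA Ev mulr1.
Qed.

Lemma invertibleZ a x : a != 0 -> invertible x -> invertible (a *: x).
Proof.
move=> a0 [y [xy yx]]; exists (a^-1 *: y).
by rewrite -!scalerAl -!scalerAr !scalerA xy yx mulfV // mulVf // scale1r.
Qed.

Lemma invertible_cnorm_lt a x : a != 0 -> cnorm (a%:A - x) < cabs a -> invertible x.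
Proof.
move=> a0 h.
have ca : 0 < cabs a by rewrite -ltcR -cabsE normr_gt0.
have : cnorm (1 - a^-1 *: x) < 1.
  have -> : 1 - a^-1 *: x = a^-1 *: (a%:A - x).
    by rewrite scalerBr scalerA mulVf // scale1r.
  rewrite cnormZc -(ltr_pM2l ca) mulrA -cabsM mulfV // cabs1 mul1r mulr1 //.
move/invertible_neumann; rewrite opprB addrCA subrr addr0.
by move/(invertibleZ a0); rewrite scalerA mulfV // scale1r.
Qed.

(** Jacobson's formula: if v inverts 1 - xy, then 1 + y v x inverts 1 - yx. This is the agreement of
    the spectra of xy and yx off 0. *)
Lemma invertible_1B_mulC x y : invertible (1 - x * y) -> invertible (1 - y * x).
Proof.
move=> [v [h1 h2]]; exists (1 + y * v * x).
have e1 : x * y * v = v - 1 by rewrite -h1 mulrBl mul1r opprB addrCA subrr addr0.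
have e2 : v * x * y = v - 1 by rewrite -h2 mulrBr mulr1 opprB addrCA subrr addr0 mulrA.
split.
  rewrite mulrBl mul1r mulrDr mulr1 -!mulrA (mulrA y v) [x * (y * v * x)](mulrA).
  rewrite !mulrA in e1 *; rewrite -(mulrA y x y) -(mulrA y (x * y) v) e1.
  by rewrite mulrBr mulr1 mulrBl [y * x + _]addrC subrK addrK.
rewrite mulrBr mulr1 mulrDl mul1r !mulrA -[y * v * x * y]mulrA -[y * v * (x * y)]mulrA.
rewrite [v * (x * y)]mulrA e2.
by rewrite mulrBr mulr1 mulrBl [y * x + _]addrC subrK addrK.
Qed.

End Invertible.

(** * Square roots and unitaries with prescribed real part *)

Section Unitaries.
Variables (R : realType) (A : cstarAlgType R).
Implicit Types (x y z u : A) (a : R[i]).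

(** Write s = 1 - w: the equation s^2 = 1 - x^2 becomes w = (x^2 + w^2) / 2. The right-hand side
    contracts with ratio m = [cnorm x] on the self-adjoint w of norm at most m that commute with
    x. *)
Lemma sqrt_one_minus_sqr x : star x = x -> cnorm x < 1 ->
  exists s, [/\ star s = s, x * s = s * x & x ^+ 2 + s ^+ 2 = 1].
Proof.
move=> sx x1; set m := cnorm x.
have m0 : 0 <= m by exact: cnorm_ge0.
have half0 : cabs (2^-1 : R[i]) = 2^-1 by rewrite half_real cabs_real ger0_norm.
pose K := [set w : A | [/\ cnorm w <= m, star w = w & w * x = x * w]].
have [||||w [_ sw wx] hw] := @cnorm_fixpoint R A K
  (fun w => (2^-1 : R[i]) *: (x ^+ 2 + w ^+ 2)) m m0 x1.
- by split; rewrite ?cnorm0 ?star0 ?mul0r ?mulr0.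
- move=> w [w1 sw wx]; split.
  + rewrite cnormZc half0 ler_pdivrMl // (le_trans (cnormD _ _)) //.
    rewrite mulr_natl mulr2n lerD //.
      by rewrite cnorm_sa_sqr // expr2 ler_piMl // ltW.
    rewrite cnorm_sa_sqr // expr2 (@le_trans _ _ (m * m)) ?ler_pM ?cnorm_ge0 //.
    by rewrite ler_piMl // ltW.
  + by rewrite half_real starZr starD !starX sx sw.
  + rewrite -scalerAl -scalerAr; congr (_ *: _).
    by rewrite mulrDl mulrDr !expr2 -(mulrA w) wx !mulrA wx.
- move=> y z [y1 _ _] [z1 _ _].
  rewrite -scalerBr cnormZc half0 ler_pdivrMl // addrDB.
  have -> : y ^+ 2 - z ^+ 2 = y * (y - z) + (y - z) * z.
    by rewrite mulrBr mulrBl subrKA !expr2.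
  apply: le_trans (cnormD _ _) _.
  have -> : 2 * (m * cnorm (y - z)) = m * cnorm (y - z) + cnorm (y - z) * m by ring.
  by rewrite lerD // (le_trans (cnormM _ _)) // ler_pM ?cnorm_ge0.
(* [K] is closed because the defect of [y] in each of its conditions is at most a constant times the
   distance from [y] to a point of [K]. *)
- move=> y hy.
  have le_e (t : A) c : (forall e, 0 < e -> cnorm t <= c * e) -> t = 0.
    move=> h; apply: cnorm_le_eps0 => e e0.
    have c1 : 0 < `|c| + 1 by rewrite ltr_wpDl.
    apply: le_trans (h (e / (`|c| + 1)) _) _; first by rewrite divr_gt0.
    rewrite mulrA ler_pdivrMr // [leRHS]mulrC ler_wpM2r ?(ltW e0) //.
    by rewrite (le_trans (ler_norm c)) // lerDl.
  split.
  + apply/ler_addgt0Pr => e e0; have [w [w1 _ _] d] := hy e e0.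
    have -> : y = w + (y - w) by rewrite addrC subrK.
    by rewrite (le_trans (cnormD _ _)) // lerD // ltW.
  + apply/eqP; rewrite -subr_eq0; apply/eqP; apply: (le_e _ 2) => e e0.
    have [w [_ sw _] d] := hy e e0.
    have -> : star y - y = star (y - w) - (y - w) by rewrite starB sw opprB addrA subrK.
    apply: le_trans (cnormB _ _) _; rewrite cnorm_star mulr_natl mulr2n.
    by rewrite lerD // ltW.
  + apply/eqP; rewrite -subr_eq0; apply/eqP; apply: (le_e _ (2 * m)) => e e0.
    have [w [_ _ wx] d] := hy e e0.
    have -> : y * x - x * y = (y - w) * x - x * (y - w).
      by rewrite mulrBl mulrBr wx opprB addrA subrK.
    apply: le_trans (cnormB _ _) _.
    have -> : 2 * m * e = e * m + m * e by ring.
    by rewrite lerD // (le_trans (cnormM _ _)) // ler_pM ?cnorm_ge0 // ltW.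
exists (1 - w); split.
- by rewrite starB star1 sw.
- by rewrite mulrBl mulrBr mul1r mulr1 wx.
- have : (2 : R[i]) *: w = x ^+ 2 + w ^+ 2.
    by rewrite -[in LHS]hw scalerA mulfV ?pnatr_eq0 // scale1r.
  rewrite scaler_nat mulr2n => e.
  have -> : x ^+ 2 = w + w - w ^+ 2 by rewrite e addrK.
  have -> : (1 - w) ^+ 2 = 1 - (w + w) + w ^+ 2.
    by rewrite expr2 mulrBl mul1r mulrBr mulr1 -expr2 opprB opprD [w ^+ 2 - w]addrC !addrA.
  by rewrite addrC -addrA [w ^+ 2 + _]addrC subrK subrK.
Qed.

Lemma unitary_of_sqr x y : star x = x -> star y = y -> x * y = y * x ->
  x ^+ 2 + y ^+ 2 = 1 ->
  star (x + 'i *: y) * (x + 'i *: y) = 1 /\ (x + 'i *: y) * star (x + 'i *: y) = 1.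
Proof.
move=> sx sy xy e.
rewrite starD starZ sx sy conjCi scaleNr.
rewrite mulrBl mulrDl !mulrDr !mulrN -!scalerAl -!scalerAr xy !scalerA ?mulNr ?mulrN -!expr2 sqrCi ?opprK.
rewrite !scaleN1r opprK; split; first by rewrite opprB addrACA subrr addr0.
by rewrite addrA subrK.
Qed.

Lemma half_add_star x y : star x = x -> star y = y ->
  x = (2^-1 : R[i]) *: ((x + 'i *: y) + star (x + 'i *: y)).
Proof.
move=> sx sy; rewrite starD starZ sx sy conjCi scaleNr addrACA subrr addr0.
have -> : x + x = (2 : R[i]) *: x by rewrite scaler_nat mulr2n.
by rewrite scalerA mulVf ?pnatr_eq0 // scale1r.
Qed.

(** [x] is the mean of the unitary x + iy and its adjoint, both of norm 1. *)
Lemma cnorm_le1_of_sqr x y : star x = x -> star y = y -> x * y = y * x ->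
  x ^+ 2 + y ^+ 2 = 1 -> cnorm x <= 1.
Proof.
move=> sx sy xy e; have [u1 _] := unitary_of_sqr sx sy xy e.
have nu := cnorm_unitary u1.
have xu := half_add_star sx sy; set u := x + _ in nu xu.
rewrite xu cnormZc half_real cabs_real ger0_norm // ler_pdivrMl // mulr1.
by rewrite (le_trans (cnormD _ _)) // cnorm_star nu.
Qed.

End Unitaries.

(** * Unital star-homomorphisms *)

Section StarHom.
Variables (R : realType) (A B : cstarAlgType R) (f : A -> B).
Hypothesis hf : unital_star_hom f.
Implicit Types (x y : A) (a : R[i]).

Lemma star_homZ a x : f (a *: x) = a *: f x.
Proof.
have f0 : f 0 = 0.
  have h := star_hom_linear hf 1 0 0; rewrite !scale1r addr0 in h.
  by apply: (addrI (f 0)); rewrite -h addr0.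
by have := star_hom_linear hf a x 0; rewrite f0 !addr0.
Qed.

Lemma star_homD x y : f (x + y) = f x + f y.
Proof. by have := star_hom_linear hf 1 x y; rewrite !scale1r. Qed.

Lemma star_hom0 : f 0 = 0.
Proof. by rewrite -(scale0r (0 : A)) star_homZ scale0r. Qed.

Lemma star_homN x : f (- x) = - f x.
Proof. by rewrite -scaleN1r star_homZ scaleN1r. Qed.

Lemma star_homB x y : f (x - y) = f x - f y.
Proof. by rewrite star_homD star_homN. Qed.

Lemma star_homX x n : f (x ^+ n) = f x ^+ n.
Proof.
elim: n => [|n IH]; first by rewrite !expr0 (star_hom1 hf).
by rewrite !exprS (star_homM hf) IH.
Qed.

(** A self-adjoint z of norm below 1 satisfies z^2 + s^2 = 1 for some self-adjoint s commuting with
    z. This relation is algebraic, so [f] preserves it, and it forces norm at most 1. Scaling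
    handles every self-adjoint element, and the C*-identity every [x]. *)
Lemma star_hom_contractive x : cnorm (f x) <= cnorm x.
Proof.
have sa y : star y = y -> cnorm (f y) <= cnorm y.
  move=> sy; apply/ler_addgt0Pr => e e0; set r := cnorm y + e.
  have r0 : 0 < r by rewrite ltr_wpDl ?cnorm_ge0.
  have sz : star (r^-1%:C *: y) = r^-1%:C *: y by rewrite starZr sy.
  have [|s [ss xs e1]] := sqrt_one_minus_sqr sz.
    by rewrite cnormZc cabs_real gtr0_norm ?invr_gt0 // ltr_pdivrMl // mulr1 ltrDl.
  have : cnorm (f (r^-1%:C *: y)) <= 1.
    apply: (@cnorm_le1_of_sqr _ _ _ (f s)).
    - by rewrite -(star_homS hf) sz.
    - by rewrite -(star_homS hf) ss.
    - by rewrite -!(star_homM hf) xs.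
    - by rewrite -!star_homX -star_homD e1 (star_hom1 hf).
  by rewrite star_homZ cnormZc cabs_real gtr0_norm ?invr_gt0 // ler_pdivrMl // mulr1.
rewrite -(@ler_pXn2r _ 2) ?nnegrE ?cnorm_ge0 //.
rewrite -!cnorm_starM -(star_homS hf) -(star_homM hf) sa //.
by rewrite starM starK.
Qed.

Lemma star_hom_invertible x : invertible x -> invertible (f x).
Proof.
move=> [y [xy yx]]; exists (f y).
by rewrite -!(star_homM hf) xy yx (star_hom1 hf).
Qed.

End StarHom.

Lemma unital_star_hom_comp (R : realType) (A B C : cstarAlgType R) (f : A -> B) (g : B -> C) :
  unital_star_hom f -> unital_star_hom g -> unital_star_hom (g \o f).
Proof.
move=> hf hg; split=> /=.
- by move=> a x y /=; rewrite (star_homD hf) (star_homZ hf) (star_homD hg) (star_homZ hg).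
- by rewrite (star_hom1 hf) (star_hom1 hg).
- by move=> x y /=; rewrite (star_homM hf) (star_homM hg).
- by move=> x /=; rewrite (star_homS hf) (star_homS hg).
Qed.

(** * Polynomial functional calculus of a self-adjoint contraction *)

Section Dft.
Variable R : realType.
Implicit Types (P p : {poly R[i]}) (M : R).

Lemma prim_root_exists (N : nat) : (0 < N)%N -> exists z : R[i], N.-primitive_root z.
Proof.
move=> N0; have [r Dp] := closed_field_poly_normal ('X^N - 1 : {poly R[i]}).
rewrite (monicP _) ?monicXnsubC // scale1r in Dp.
have rn1 : all N.-unity_root r by apply/allP=> z; rewrite -root_prod_XsubC -Dp.
have sz_r : (N < (size r).+1)%N by rewrite -(size_prod_XsubC r id) -Dp size_XnsubC.
have [|z _ hz] := hasP (has_prim_root N0 rn1 _ sz_r); last by exists z.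
by rewrite -separable_prod_XsubC -Dp separable_Xn_sub_1 // pnatr_eq0 -lt0n.
Qed.

Lemma cabs_unity_root N (z : R[i]) : (0 < N)%N -> z ^+ N = 1 -> cabs z = 1.
Proof.
move=> N0 h; apply/eqP; rewrite -(@pexpr_eq1 _ (cabs z) N) ?cabs_ge0 //.
by rewrite -cabsX h cabs1.
Qed.

Lemma sum_unity_root N (z : R[i]) : z ^+ N = 1 -> z != 1 -> \sum_(j < N) z ^+ j = 0.
Proof.
move=> h z1; have := subrX1 z N; rewrite h subrr => /esym/eqP.
by rewrite mulf_eq0 subr_eq0 (negbTE z1) => /eqP.
Qed.

(* The coefficients of [P] are the discrete Fourier transform of its values at the roots of unity. *)
Lemma cabs_coef_le P N M : (size P <= N)%N ->
  (forall z, cabs z = 1 -> cabs P.[z] <= M) -> forall k, cabs P`_k <= M.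
Proof.
move=> sP bP k.
have M0 : 0 <= M by apply: le_trans (cabs_ge0 _) (bP 1 _); rewrite cabs1.
have [kN|] := ltnP k N; last by move=> ?; rewrite nth_default ?cabs0 // (leq_trans sP).
have N0 : (0 < N)%N by exact: leq_ltn_trans kN.
have [z hz] := prim_root_exists N0.
have zN := prim_expr_order hz.
have z0 : z != 0 by apply: contra_eq_neq zN => ->; rewrite expr0n gtn_eqF ?eqxx // eq_sym oner_neq0.
have cz := cabs_unity_root N0 zN.
have e : N%:R * P`_k = \sum_(j < N) (z ^+ j) ^- k * P.[z ^+ j].
  under eq_bigr do rewrite (horner_coef_wide _ sP) mulr_sumr.
  rewrite exchange_big /= (bigD1 (Ordinal kN)) //= [X in _ + X]big1 ?addr0.
    under eq_bigr => j _.
      rewrite mulrCA mulVf ?mulr1; last by rewrite expf_neq0 // expf_neq0.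
      over.
    by rewrite sumr_const card_ord mulr_natl.
  move=> i ik.
  have E j : (z ^+ j) ^- k * (P`_i * z ^+ j ^+ i) = P`_i * (z ^+ i / z ^+ k) ^+ j.
    rewrite mulrCA; congr (_ * _).
    by rewrite exprMn exprVn mulrC -!exprM (mulnC j i) (mulnC j k).
  under eq_bigr do rewrite E.
  rewrite -mulr_sumr sum_unity_root ?mulr0 //.
    by rewrite exprMn exprVn -!exprM ![(_ * N)%N]mulnC !exprM zN !expr1n invr1 mulr1.
  apply: contra ik => /eqP h; have : z ^+ i = z ^+ k.
    by apply: divr1_eq.
  by move/eqP; rewrite (eq_prim_root_expr hz) !modn_small // => /eqP h'; apply/eqP/val_inj.
have NR : (0 : R) < N%:R by rewrite ltr0n.
rewrite -(ler_pM2l NR) -[in leLHS]cabs_nat -cabsM e.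
apply: le_trans (cabs_sum _ _ _) _.
have -> : N%:R * M = \sum_(j < N) M by rewrite sumr_const card_ord mulr_natl.
apply: ler_sum => j _; rewrite cabsM.
have cj i : cabs (z ^+ i) = 1 by rewrite cabsX cz expr1n.
have -> : cabs ((z ^+ j) ^- k) = 1.
  by rewrite (@cabs_unity_root N) // exprVn -!exprM mulnC exprM zN expr1n invr1.
by rewrite mul1r bP // cj.
Qed.

End Dft.

Section PolyEval.
Variables (R : realType) (A : cstarAlgType R).
Implicit Types (x y u : A) (p P : {poly R[i]}) (M : R).

Definition peval x p : A := horner_alg x p.

Lemma pevalD x p P : peval x (p + P) = peval x p + peval x P.
Proof. exact: rmorphD. Qed.

Lemma pevalB x p P : peval x (p - P) = peval x p - peval x P.
Proof. exact: rmorphB. Qed.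

Lemma pevalM x p P : peval x (p * P) = peval x p * peval x P.
Proof. exact: rmorphM. Qed.

Lemma pevalXn x p n : peval x (p ^+ n) = peval x p ^+ n.
Proof. exact: rmorphXn. Qed.

Lemma pevalZ x a p : peval x (a *: p) = a *: peval x p.
Proof. by rewrite -mul_polyC pevalM /peval horner_algC mulr_algl. Qed.

Lemma pevalC x a : peval x a%:P = a%:A.
Proof. exact: horner_algC. Qed.

Lemma peval1 x : peval x 1 = 1.
Proof. exact: rmorph1. Qed.

Lemma pevalX x : peval x 'X = x.
Proof. exact: horner_algX. Qed.

Lemma peval_sum x (I : Type) (s : seq I) (Q : pred I) (F : I -> {poly R[i]}) :
  peval x (\sum_(i <- s | Q i) F i) = \sum_(i <- s | Q i) peval x (F i).
Proof. exact: rmorph_sum. Qed.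

Lemma poly_widen p n : (size p <= n)%N -> p = \sum_(i < n) p`_i *: 'X^i.
Proof.
move=> sp; rewrite -poly_def; apply/polyP => i; rewrite coef_poly.
by case: ltnP => // ni; rewrite nth_default // (leq_trans sp).
Qed.

Lemma peval_wide x p n : (size p <= n)%N -> peval x p = \sum_(i < n) p`_i *: x ^+ i.
Proof.
move=> sp; rewrite {1}(poly_widen sp) peval_sum.
by apply: eq_bigr => i _; rewrite pevalZ pevalXn pevalX.
Qed.

Lemma star_peval x p : star x = x -> star (peval x p) = peval x (map_poly Num.conj p).
Proof.
move=> sx; have sp := leqnn (size p).
have sp' : (size (map_poly Num.conj p) <= size p)%N by rewrite size_poly.
rewrite (peval_wide _ sp) (peval_wide _ sp').
have star_sum (I : Type) (s : seq I) (F : I -> A) :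
    star (\sum_(i <- s) F i) = \sum_(i <- s) star (F i).
  by elim/big_rec2: _ => [|i y z _ <-]; rewrite ?star0 // starD.
rewrite star_sum; apply: eq_bigr => i _.
by rewrite starZ starX sx coef_map.
Qed.

Lemma peval_comp_opp x p : peval x (p \Po - 'X) = peval (- x) p.
Proof.
rewrite comp_polyE peval_sum (peval_wide _ (leqnn _)); apply: eq_bigr => i _.
by rewrite pevalZ pevalXn -[- 'X]scaleN1r pevalZ pevalX scaleN1r.
Qed.

(** The triangle inequality over at most [N] coefficients, each bounded by [M]. The factor [N] is
    lost here and recovered later by taking powers. *)
Lemma peval_unitary_le u P N M : star u * u = 1 -> (size P <= N)%N ->
  (forall z, cabs z = 1 -> cabs P.[z] <= M) -> cnorm (peval u P) <= N%:R * M.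
Proof.
move=> hu sP bP; rewrite (peval_wide _ sP).
apply: le_trans (cnorm_sum _ _ _) _.
have -> : N%:R * M = \sum_(j < N) M by rewrite sumr_const card_ord mulr_natl.
apply: ler_sum => i _; rewrite cnormZc.
have cn := cabs_coef_le sP bP i.
rewrite -[leRHS]mulr1 ler_pM ?cabs_ge0 ?cnorm_ge0 //.
by rewrite (le_trans (cnormX _ _)) // (cnorm_unitary hu) expr1n.
Qed.

(* [X^d p((X + 1/X)/2)] is a polynomial, and it turns [p(x)] into a polynomial in the unitary [u]. *)
Lemma peval_Re_unitary_le u x p d M : star u * u = 1 -> u * star u = 1 ->
  x = (2^-1 : R[i]) *: (u + star u) -> (size p <= d.+1)%N ->
  (forall s : R, `|s| <= 1 -> cabs p.[s%:C] <= M) ->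
  cnorm (peval x p) <= (2 * d + 1)%:R * M.
Proof.
move=> uu1 uu2 ex sp bp.
(* At z on the circle [q] takes the value z Re z. Padding the k-th term of [P] with X^(d-k) makes
   P(z) = z^d p(Re z), and likewise P(u) = p(x) u^d, with P of degree at most 2d. *)
pose q : {poly R[i]} := 2^-1 *: ('X^2 + 1).
pose P := \sum_(k < d.+1) p`_k *: (q ^+ k * 'X^(d - k)).
have sq : (size q <= 3)%N.
  rewrite (leq_trans (size_scale_leq _ _)) // (leq_trans (size_polyD _ _)) //.
  by rewrite size_polyXn size_poly1.
have sP : (size P <= 2 * d + 1)%N.
  rewrite (leq_trans (size_sum _ _ _)) //; apply/bigmax_leqP => k _.
  rewrite (leq_trans (size_scale_leq _ _)) // (leq_trans (size_polyMleq _ _)) //.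
  rewrite size_polyXn addnS /=.
  have : (size (q ^+ k) <= (2 * k).+1)%N.
    rewrite (leq_trans (size_poly_exp_leq _ _)) // ltnS leq_mul2r.
    by case: (size q) sq => [|[|[|[|]]]] //= _; rewrite orbT.
  move=> /leq_add h; apply: leq_trans (h _ _ (leqnn _)) _.
  by have kd : (k < d.+1)%N := ltn_ord k; move: (nat_of_ord k) kd => j; lia.
have uxC : u * x = x * u.
  by rewrite ex -scalerAl -scalerAr mulrDl mulrDr uu1 uu2.
have qu : peval u q = x * u.
  rewrite pevalZ pevalD pevalXn pevalX peval1 ex -scalerAl; congr (_ *: _).
  by rewrite mulrDl uu1 expr2.
have ePu : peval u P = peval x p * u ^+ d.
  rewrite (peval_wide _ sp) mulr_suml peval_sum; apply: eq_bigr => k _.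
  rewrite pevalZ pevalM !pevalXn pevalX qu -scalerAl; congr (_ *: _).
  rewrite exprMn_comm //.
  by rewrite -mulrA -exprD subnKC // -ltnS.
have -> : peval x p = peval u P * (star u) ^+ d.
  rewrite ePu -mulrA -exprMn_comm ?uu2 ?expr1n ?mulr1 //.
  by rewrite /GRing.comm uu1 uu2.
have n1 : cnorm (star u ^+ d) <= 1.
  by rewrite (le_trans (cnormX _ _)) // cnorm_star (cnorm_unitary uu1) expr1n.
apply: (@le_trans _ _ (cnorm (peval u P))).
  by rewrite (le_trans (cnormM _ _)) // ler_piMr ?cnorm_ge0.
apply: peval_unitary_le => // z cz.
have zz : z * z^* = 1 by rewrite -normCK cabsE cz expr1n.
pose s := complex.Re z.
have sz : s%:C = 2^-1 * (z + z^*).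
  by case: (z) @s => a b /=; apply/eqP; rewrite eq_complex /=; apply/andP; split; apply/eqP; field.
have s1 : `|s| <= 1 by rewrite -cz Re_le_cabs.
have -> : P.[z] = p.[s%:C] * z ^+ d.
  rewrite (horner_coef_wide _ sp) mulr_suml horner_sum; apply: eq_bigr => k _.
  rewrite hornerZ hornerM horner_exp hornerZ hornerD !hornerXn hornerC.
  have -> : 2^-1 * (z ^+ 2 + 1) = s%:C * z by rewrite sz -zz; ring.
  by rewrite exprMn -!mulrA -exprD subnKC // -ltnS.
by rewrite cabsM cabsX cz expr1n mulr1 bp.
Qed.

End PolyEval.

Lemma bernoulli_le (R : realType) (b : R) n : 0 <= b -> 1 + n%:R * b <= (1 + b) ^+ n.
Proof.
move=> b0; elim: n => [|n IH]; first by rewrite mul0r addr0 expr0.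
rewrite exprS; apply: le_trans (ler_wpM2l _ IH); last by rewrite addr_ge0.
rewrite -natr1; have : 0 <= n%:R * (b * b) by rewrite !mulr_ge0.
by nra.
Qed.

(** If a = (1 + b) M with b > 0, then (1 + b)^(2^k) would grow at most linearly in 2^k, whereas the
    square of Bernoulli's inequality makes it grow quadratically. *)
Lemma le_of_pow2_le (R : realType) (a M : R) (D : nat) : 0 <= a -> 0 <= M ->
  (forall k, a ^+ (2 ^ k) <= (D * 2 ^ k + 1)%:R * M ^+ (2 ^ k)) -> a <= M.
Proof.
move=> a0 M0 h; rewrite leNgt; apply/negP => Ma.
have [M00|Mn0] := eqVneq M 0.
  by have := h 0%N; rewrite M00 !expr1 mulr0 leNgt -M00 Ma.
have M_gt0 : 0 < M by rewrite lt0r Mn0.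
pose b := a / M - 1.
have b0 : 0 < b by rewrite subr_gt0 ltr_pdivlMr // mul1r.
have ht k : (1 + b) ^+ (2 ^ k) <= (D * 2 ^ k + 1)%:R.
  by rewrite /b addrC subrK expr_div_n ler_pdivrMr ?exprn_gt0.
(* With m = 2^k: (m b)^2 <= (1 + b)^(2m) <= 2Dm + 1 <= 2(D + 1)m; divide by m. *)
have hb k : (2 ^ k)%:R * b ^+ 2 <= (2 * (D + 1))%:R.
  have k0 : (0 : R) < (2 ^ k)%:R by rewrite ltr0n expn_gt0.
  rewrite -(ler_pM2l k0).
  have e1 : (2 ^ k)%:R * ((2 ^ k)%:R * b ^+ 2) <= (1 + b) ^+ (2 ^ k.+1).
    rewrite expnSr exprM mulrA -expr2 -exprMn.
    have p1 : 0 <= (2 ^ k)%:R * b by rewrite mulr_ge0 ?ltW.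
    have p2 : (2 ^ k)%:R * b <= (1 + b) ^+ (2 ^ k).
      by apply: le_trans (bernoulli_le _ (ltW b0)); rewrite lerDr.
    by rewrite ler_pXn2r // nnegrE // (le_trans p1).
  apply: (le_trans e1); apply: (le_trans (ht _)).
  rewrite -natrM ler_nat expnS.
  have : (0 < 2 ^ k)%N by rewrite expn_gt0.
  by move: (2 ^ k)%N => m; lia.
have := archi_boundP (_ : 0 <= (2 * (D + 1))%:R / b ^+ 2).
rewrite divr_ge0 ?exprn_ge0 ?(ltW b0) // => /(_ isT).
set n := Num.Def.archi_bound _; rewrite ltr_pdivrMr ?exprn_gt0 // ltNge.
move=> /negP; apply; apply: le_trans (hb n).
by rewrite ler_wpM2r ?exprn_ge0 ?(ltW b0) // ler_nat ltnW // ltn_expl.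
Qed.

Section PevalBound.
Variables (R : realType) (A : cstarAlgType R).
Implicit Types (x y u : A) (p P : {poly R[i]}) (M : R).

Lemma horner_conj_real p (s : R) : (map_poly Num.conj p).[s%:C] = (p.[s%:C])^*.
Proof. by rewrite -{1}(conj_real s) horner_map. Qed.

(* The polynomial loss in [peval_Re_unitary_le] disappears on applying it to high powers of [p^* p]. *)
Lemma cnorm_peval_lt1 x p M : star x = x -> cnorm x < 1 ->
  (forall s : R, `|s| <= 1 -> cabs p.[s%:C] <= M) -> cnorm (peval x p) <= M.
Proof.
move=> sx x1 bp.
have M0 : 0 <= M by apply: le_trans (cabs_ge0 _) (bp 0 _); rewrite normr0.
have [s [ss xs e1]] := sqrt_one_minus_sqr sx x1.
have [uu1 uu2] := unitary_of_sqr sx ss xs e1.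
have xu := half_add_star sx ss; set u := x + _ in uu1 uu2 xu.
pose r := map_poly Num.conj p * p.
have yr : peval x r = star (peval x p) * peval x p by rewrite pevalM star_peval.
have sr : star (peval x r) = peval x r by rewrite yr starM starK.
have br t : `|t| <= 1 -> cabs r.[t%:C] <= M ^+ 2.
  move=> t1; rewrite hornerM cabsM horner_conj_real cabs_conj expr2.
  by rewrite ler_pM ?cabs_ge0 ?bp.
rewrite -(@ler_pXn2r _ 2) ?nnegrE ?cnorm_ge0 // -cnorm_starM -yr.
(* The degree of [r ^+ (2 ^ k)] is at most [(size r).-1 * 2 ^ k], so the loss is linear in 2^k. *)
apply: (@le_of_pow2_le _ _ _ (2 * (size r).-1)); rewrite ?cnorm_ge0 ?exprn_ge0 //.
move=> k; rewrite -cnorm_sa_pow2 // -pevalXn -mulnA.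
apply: (peval_Re_unitary_le uu1 uu2 xu); first exact: size_poly_exp_leq.
move=> t t1; rewrite horner_exp cabsX ler_pXn2r ?nnegrE ?cabs_ge0 ?exprn_ge0 ?br //.
by rewrite expn_gt0.
Qed.

(** Control of p(rx) as r tends to 1, which extends the bound for norm below 1 to norm at most 1.
    The bounds on the value and on the increment are proved together, since the product rule for pX
    + c uses both. *)
Lemma peval_scaled_lipschitz x p : exists2 C : R, 0 <= C &
  forall r : R, 0 <= r <= 1 ->
    cnorm (peval (r%:C *: x) p) <= C /\
    cnorm (peval x p - peval (r%:C *: x) p) <= C * (1 - r).
Proof.
elim/poly_ind: p => [|p c [C C0 IH]].
  by exists 0 => // r r01; rewrite /peval !rmorph0 subrr cnorm0 mul0r.
have nx := cnorm_ge0 x.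
(* The increment of pX has two parts, each at most C ||x|| (1 - r); the constant term only affects
   the value. *)
exists (2 * C * cnorm x + cabs c); first by rewrite addr_ge0 ?cabs_ge0 // !mulr_ge0.
move=> r /andP[r0 r1]; have [|h1 h2] := IH r; first by rewrite r0.
have cr : cabs r%:C = r by rewrite cabs_real ger0_norm.
rewrite !pevalD !pevalM !pevalX !pevalC; split.
  apply: le_trans (cnormD _ _) _; rewrite cnormZc cnorm1 mulr1 lerD2r.
  apply: le_trans (cnormM _ _) _; rewrite cnormZc cr.
  have : cnorm (peval (r%:C *: x) p) * (r * cnorm x) <= C * (1 * cnorm x).
    by rewrite ler_pM ?cnorm_ge0 ?mulr_ge0 // ler_wpM2r.
  have : 0 <= C * cnorm x by rewrite mulr_ge0.
  by lra.
rewrite [X in X - _]addrC [X in _ - X]addrC addrDB.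
have -> : peval x p * x - peval (r%:C *: x) p * (r%:C *: x) =
    (peval x p - peval (r%:C *: x) p) * x
    + (1 - r)%:C *: (peval (r%:C *: x) p * x).
  by rewrite -scalerAr mulrBl rmorphB /= scalerBl scale1r addrA subrK.
apply: le_trans (cnormD _ _) _; rewrite cnormZc cabs_real ger0_norm ?subr_ge0 //.
have a1 := le_trans (cnormM (peval x p - peval (r%:C *: x) p) x) (ler_wpM2r nx h2).
have a2 := le_trans (cnormM (peval (r%:C *: x) p) x) (ler_wpM2r nx h1).
have r1' : 0 <= 1 - r by rewrite subr_ge0.
have a3 := ler_wpM2l r1' a2.
have a4 : 0 <= cabs c * (1 - r) by rewrite mulr_ge0 ?cabs_ge0.
by apply: le_trans (lerD a1 a3) _; lra.
Qed.

Lemma cnorm_peval x p M : star x = x -> cnorm x <= 1 ->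
  (forall s : R, `|s| <= 1 -> cabs p.[s%:C] <= M) -> cnorm (peval x p) <= M.
Proof.
move=> sx x1 bp; have [C C0 h] := peval_scaled_lipschitz x p.
apply/ler_addgt0Pr => e e0.
have Ce : 0 < C + e by rewrite ltr_wpDl.
(* Chosen so that 0 < d <= 1 and C d <= e; the strict bound is applied to (1 - d) x. *)
pose d := e / (C + e); have d0 : 0 < d by rewrite divr_gt0.
have d1 : d <= 1 by rewrite ler_pdivrMr // mul1r lerDr.
have [|_ h2] := h (1 - d); first by rewrite subr_ge0 d1 gerBl ltW.
rewrite -(subrK (peval ((1 - d)%:C *: x) p) (peval x p)) addrC.
apply: le_trans (cnormD _ _) _; rewrite lerD //.
  apply: cnorm_peval_lt1 bp; first by rewrite starZr sx.
  rewrite cnormZc cabs_real ger0_norm ?subr_ge0 //.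
  apply: le_lt_trans (_ : (1 - d) * 1 < 1); first by rewrite ler_wpM2l ?subr_ge0.
  by rewrite mulr1 gtrBl.
apply: le_trans h2 _; rewrite opprB addrC subrK /d mulrA ler_pdivrMr // mulrC.
by rewrite ler_wpM2l ?(ltW e0) // lerDl ltW.
Qed.

End PevalBound.

(** * Weierstrass approximation *)

Section Weierstrass.
Variable R : realType.
Implicit Types (h : R -> R[i]) (s t e d M : R).

(* The Bernstein operators, by conditioning on the first of [n] Bernoulli trials. *)
Fixpoint bernstein n (phi : nat -> R[i]) : {poly R[i]} :=
  if n is m.+1 then (1 - 'X) * bernstein m phi + 'X * bernstein m (phi \o succn)
  else (phi 0%N)%:P.

Fixpoint binomial_mean n t (phi : nat -> R) : R :=
  if n is m.+1 then (1 - t) * binomial_mean m t phi + t * binomial_mean m t (phi \o succn)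
  else phi 0%N.

Lemma bernstein_dist n t phi c : 0 <= t <= 1 ->
  cabs (c - (bernstein n phi).[t%:C]) <= binomial_mean n t (fun k => cabs (c - phi k)).
Proof.
move=> /andP[t0 t1]; elim: n phi => [|n IH] phi /=; first by rewrite hornerC.
rewrite hornerD !hornerM hornerD hornerN hornerX hornerC.
have -> : c - ((1 - t%:C) * (bernstein n phi).[t%:C]
             + t%:C * (bernstein n (phi \o succn)).[t%:C]) =
  (1 - t)%:C * (c - (bernstein n phi).[t%:C])
  + t%:C * (c - (bernstein n (phi \o succn)).[t%:C]).
  by rewrite rmorphB /=; ring.
apply: le_trans (cabsD _ _) _; rewrite !cabsM !cabs_real !ger0_norm ?subr_ge0 //.
by rewrite lerD // ler_wpM2l ?subr_ge0 //; apply: IH.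
Qed.

Lemma binomial_mean_le n t phi psi : 0 <= t <= 1 ->
  (forall k, (k <= n)%N -> phi k <= psi k) -> binomial_mean n t phi <= binomial_mean n t psi.
Proof.
move=> /andP[t0 t1]; elim: n phi psi => [|n IH] phi psi hk /=; first exact: hk.
rewrite lerD // ler_wpM2l ?subr_ge0 //; apply: IH => k kn; apply: hk => //.
exact: leqW.
Qed.

Lemma binomial_mean_affine n t a b phi :
  binomial_mean n t (fun k => a + b * phi k) = a + b * binomial_mean n t phi.
Proof.
elim: n phi => //= n IH phi; rewrite IH.
by rewrite [binomial_mean n t (_ \o succn)](IH (phi \o succn)); ring.
Qed.

(** Variance plus squared bias. The centre [a] is arbitrary because conditioning on the first trial
    moves it by 1. *)
Lemma binomial_variance n t a :
  binomial_mean n t (fun k => (k%:R - a) ^+ 2) = n%:R * t * (1 - t) + (n%:R * t - a) ^+ 2.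
Proof.
elim: n a => [|n IH] a /=; first by ring.
have -> : (fun k => (k%:R - a) ^+ 2) \o succn = fun k : nat => (k%:R - (a - 1)) ^+ 2.
  by apply/funext => k /=; rewrite -natr1 opprB addrA.
by rewrite !IH -natr1; ring.
Qed.

Definition cont_on_segment h := forall s e, `|s| <= 1 -> 0 < e ->
  exists2 d, 0 < d & forall t, `|t| <= 1 -> `|s - t| < d -> cabs (h s - h t) <= e.

(** Heine-Cantor by near-covering compactness: it suffices that, around each point of the segment,
    every d close enough to 0 on the right works for all nearby s. *)
Lemma cont_on_segment_unif h e : cont_on_segment h -> 0 < e ->
  exists2 d, 0 < d & forall s t, `|s| <= 1 -> `|t| <= 1 -> `|s - t| < d ->
    cabs (h s - h t) <= e.
Proof.
move=> ch e0.
have /compact_near_coveringP cK := @segment_compact R (-1) 1.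
have K s : (s \in `[(-1 : R), 1]) = (`|s| <= 1) by rewrite in_itv /= ler_norml.
have := cK _ (0^'+ : set_system R)
  (fun d s => forall t, `|s| <= 1 -> `|t| <= 1 -> `|s - t| < d -> cabs (h s - h t) <= e) _.
case.
- move=> s /=; rewrite K => s1.
  have e2 : 0 < e / 2 by rewrite divr_gt0.
  have [d d0 hd] := ch s (e / 2) s1 e2.
  have d2 : 0 < d / 2 by rewrite divr_gt0.
  exists (ball s (d / 2), [set x : R | x < d / 2]) => /=.
    by split; [exact: nbhsx_ballx | exact: nbhs_right_lt].
  move=> [t r] [/= st rd] u t1 u1 tu.
  have st' : `|s - t| < d / 2 by exact: st.
  rewrite -(subrKA (h s)); apply: le_trans (cabsD _ _) _.
  rewrite [leRHS]splitr cabsB lerD // hd //.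
    by rewrite (lt_trans st') // ltr_pdivrMr // ltr_pMr // ltr1n.
  rewrite -(subrKA t) (le_lt_trans (ler_normD _ _)) // [ltRHS]splitr ltrD //.
  exact: lt_trans rd.
- move=> d /= d0 hd.
  exists (d / 2); first by rewrite divr_gt0.
  move=> s t s1 t1 st; apply: (hd (d / 2)) st => //=.
  + by rewrite sub0r normrN ger0_norm ?divr_ge0 ?(ltW d0) // ltr_pdivrMr // ltr_pMr // ltr1n.
  + by rewrite divr_gt0.
  + by rewrite K.
Qed.

Lemma cont_on_segment_bounded h : cont_on_segment h ->
  exists2 M, 0 < M & forall s, `|s| <= 1 -> cabs (h s) <= M.
Proof.
move=> ch.
have /compact_near_coveringP cK := @segment_compact R (-1) 1.
have K s : (s \in `[(-1 : R), 1]) = (`|s| <= 1) by rewrite in_itv /= ler_norml.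
have := cK _ (+oo : set_system R) (fun M s => `|s| <= 1 -> cabs (h s) <= M) _.
case.
- move=> s /=; rewrite K => s1.
  have [d d0 hd] := ch s 1 s1 ltr01.
  exists (ball s d, [set x : R | cabs (h s) + 1 < x]) => /=.
    by split; [exact: nbhsx_ballx | apply: nbhs_pinfty_gt; exact: num_real].
  move=> [t r] [/= st rd] t1.
  have st' : `|s - t| < d by exact: st.
  apply: le_trans (ltW rd); rewrite -[h t](subrK (h s)) addrC.
  by apply: le_trans (cabsD _ _) _; rewrite lerD2l cabsB hd.
- move=> M [_ /= hM]; exists (`|M| + 1); first by rewrite ltr_wpDl.
  move=> s s1; apply: (hM (`|M| + 1)); rewrite /= ?K //.
  by rewrite (le_lt_trans (ler_norm M)) // ltrDl.
Qed.

(** Bernstein's proof: |h(s) - h(t)| <= e/2 + c (s - t)^2 holds by uniform continuity for close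
    points and by boundedness for the others. Averaging over the binomial law turns the square into
    a variance of order 1/n. *)
Theorem weierstrass h e : cont_on_segment h -> 0 < e ->
  exists p : {poly R[i]}, forall s, `|s| <= 1 -> cabs (h s - p.[s%:C]) <= e.
Proof.
move=> ch e0; have [M M0 hM] := cont_on_segment_bounded ch.
have e2 : 0 < e / 2 by rewrite divr_gt0.
have [d d0 hd] := cont_on_segment_unif ch e2.
pose c := 2 * M / d ^+ 2.
have c0 : 0 < c by rewrite !mulr_gt0 ?invr_gt0 ?exprn_gt0.
have cov s t : `|s| <= 1 -> `|t| <= 1 -> cabs (h s - h t) <= e / 2 + c * (s - t) ^+ 2.
  move=> s1 t1; have [st|st] := ltP `|s - t| d.
    by rewrite (le_trans (hd _ _ s1 t1 st)) // lerDl mulr_ge0 ?sqr_ge0 ?ltW.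
  apply: le_trans (cabsD _ _) _; rewrite cabsN.
  apply: le_trans (lerD (hM _ s1) (hM _ t1)) _.
  have : M + M <= c * (s - t) ^+ 2.
    have : d ^+ 2 <= (s - t) ^+ 2 by rewrite -(real_normK (num_real (s - t))) ler_pXn2r ?nnegrE ?(ltW d0).
    rewrite -(ler_pM2l c0); apply: le_trans; rewrite /c.
    by rewrite divfK ?gt_eqF ?exprn_gt0 // mulr_natl mulr2n.
  by have := ltW e2; lra.
(* Under s = 2t - 1 the quadratic term averages to 4c t(1 - t)/n <= c/n, which such an [n] brings
   below e/2. *)
have [n n0 hn] : exists2 n, (0 : R) < n%:R & 4 * c / e < n%:R.
  exists (Num.Def.archi_bound (4 * c / e)).+1; first by rewrite ltr0n.
  have c4 : 0 <= 4 * c / e by rewrite ltW // divr_gt0 // mulr_gt0.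
  by apply: lt_trans (archi_boundP c4) _; rewrite ltr_nat.
(* The Bernstein nodes k/n carried from [0, 1] to [-1, 1]. *)
pose g (k : nat) : R := 2 * (k%:R / n%:R) - 1.
exists (bernstein n (h \o g) \Po (2^-1 *: ('X + 1))) => s s1.
have [sl sr] : -1 <= s /\ s <= 1 by move: s1; rewrite ler_norml => /andP[].
pose t := (s + 1) / 2.
have t01 : 0 <= t <= 1 by rewrite /t; apply/andP; split; lra.
have st : s = 2 * t - 1 by rewrite /t; field.
rewrite horner_comp hornerZ hornerD hornerX hornerC.
have -> : 2^-1 * (s%:C + 1) = t%:C.
  by rewrite /t rmorphM fmorphV rmorphD rmorph1 rmorph_nat mulrC.
apply: le_trans (bernstein_dist _ _ _ t01) _.
have : binomial_mean n t (fun k => cabs (h s - (h \o g) k)) <=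
       binomial_mean n t (fun k => e / 2 + (4 * c / n%:R ^+ 2) * (k%:R - n%:R * t) ^+ 2).
  apply: binomial_mean_le => // k kn /=.
  have gk : `|g k| <= 1.
    have k0 : (0 : R) <= k%:R / n%:R by exact: divr_ge0.
    have k1 : (k%:R / n%:R : R) <= 1 by rewrite ler_pdivrMr // mul1r ler_nat.
    by rewrite ler_norml /g; apply/andP; split; lra.
  apply: le_trans (cov _ _ s1 gk) _; rewrite lerD2l st /g.
  rewrite le_eqVlt; apply/orP; left; apply/eqP; field.
  by rewrite gt_eqF.
move=> /le_trans; apply.
rewrite binomial_mean_affine binomial_variance subrr expr0n addr0.
have -> : 4 * c / n%:R ^+ 2 * (n%:R * t * (1 - t)) = 4 * c * (t * (1 - t)) / n%:R.
  by field; rewrite gt_eqF.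
rewrite [leRHS]splitr lerD2l ler_pdivrMr //.
have t4 : t * (1 - t) <= 4^-1 by have := sqr_ge0 (t - 2^-1); rewrite expr2; lra.
rewrite ltr_pdivrMr // in hn.
have : 4 * c * (t * (1 - t)) <= 4 * c * 4^-1 by rewrite ler_wpM2l // ltW // mulr_gt0.
by have := mulr_gt0 n0 e0; lra.
Qed.

End Weierstrass.

(** * Continuous functional calculus *)

Section FunctionalCalculus.
Variables (R : realType) (A : cstarAlgType R).
Implicit Types (x y : A) (p : {poly R[i]}) (h : R -> R[i]) (M : R).

(* The graph of the continuous functional calculus [h |-> h(x)], as the closure of the polynomial one. *)
Definition fcalc x h y := forall e, 0 < e -> exists2 p : {poly R[i]},
  forall s, `|s| <= 1 -> cabs (h s - p.[s%:C]) <= e & cnorm (y - peval x p) <= e.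

Lemma fcalc_poly x p : fcalc x (fun s => p.[s%:C]) (peval x p).
Proof.
move=> e e0; exists p; last by rewrite subrr cnorm0 ltW.
by move=> s _; rewrite subrr cabs0 ltW.
Qed.

Lemma fcalc_eq x h g y : (forall s, `|s| <= 1 -> h s = g s) -> fcalc x h y -> fcalc x g y.
Proof.
move=> hg hy e e0; have [p hp yp] := hy e e0; exists p => // s s1.
by rewrite -hg // hp.
Qed.

Lemma fcalcD x h g y z : fcalc x h y -> fcalc x g z -> fcalc x (fun s => h s + g s) (y + z).
Proof.
move=> hy gz e e0; have e2 : 0 < e / 2 by rewrite divr_gt0.
have [p hp yp] := hy _ e2; have [q gq zq] := gz _ e2.
exists (p + q) => [s s1|].
  rewrite hornerD opprD addrACA [leRHS]splitr.
  by apply: le_trans (cabsD _ _) _; rewrite lerD ?hp ?gq.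
rewrite pevalD opprD addrACA [leRHS]splitr.
by apply: le_trans (cnormD _ _) _; rewrite lerD.
Qed.

Lemma fcalcZ x h y a : fcalc x h y -> fcalc x (fun s => a * h s) (a *: y).
Proof.
move=> hy e e0.
have c0 : 0 < cabs a + 1 by rewrite ltr_wpDl ?cabs_ge0.
have [|p hp yp] := hy (e / (cabs a + 1)); first by rewrite divr_gt0.
have le_e b : b <= e / (cabs a + 1) -> cabs a * b <= e.
  move=> hb; apply: le_trans (ler_wpM2l (cabs_ge0 _) hb) _.
  by rewrite mulrA ler_pdivrMr // mulrC ler_wpM2l ?(ltW e0) // lerDl.
exists (a *: p) => [s s1|].
  by rewrite hornerZ -mulrBr cabsM le_e // hp.
by rewrite pevalZ -scalerBr cnormZc le_e.
Qed.

Lemma fcalcM x h g y z M : (forall s, `|s| <= 1 -> cabs (h s) <= M) ->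
  (forall s, `|s| <= 1 -> cabs (g s) <= M) ->
  fcalc x h y -> fcalc x g z -> fcalc x (fun s => h s * g s) (y * z).
Proof.
move=> hM gM hy gz e e0.
(* Once the errors are at most d <= 1, [K] bounds the functions, the elements and their
   approximants, so either product errs by at most 2Kd. *)
pose K := `|M| + cnorm y + cnorm z + 1.
have M0 := normr_ge0 M; have y0 := cnorm_ge0 y; have z0 := cnorm_ge0 z.
have K0 : 0 < K by rewrite /K; lra.
pose d := Num.min 1 (e / (2 * K)).
have d0 : 0 < d by rewrite lt_min ltr01 divr_gt0 // mulr_gt0.
have d1 : d <= 1 by rewrite ge_min lexx.
have dK : 2 * (K * d) <= e.
  have : d <= e / (2 * K) by rewrite ge_min lexx orbT.
  by rewrite ler_pdivlMr ?mulr_gt0 //; lra.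
have [p hp yp] := hy _ d0; have [q gq zq] := gz _ d0.
have bound (a b a' b' : R) : 0 <= b -> 0 <= a -> 0 <= a' -> 0 <= b' ->
    a <= K -> b <= d -> a' <= d -> b' <= K -> a * b + a' * b' <= e.
  move=> *; apply: le_trans dK.
  have -> : 2 * (K * d) = K * d + d * K by ring.
  by rewrite lerD // ler_pM.
exists (p * q) => [s s1|].
  have -> : h s * g s - (p * q).[s%:C] =
      h s * (g s - q.[s%:C]) + (h s - p.[s%:C]) * q.[s%:C] by rewrite hornerM; ring.
  apply: le_trans (cabsD _ _) _; rewrite !cabsM; apply: bound; rewrite ?cabs_ge0 ?hp ?gq //.
    by rewrite (le_trans (hM _ s1)) // /K; have := ler_norm M; lra.
  rewrite -(subKr (g s) q.[s%:C]) (le_trans (cabsD _ _)) // cabsN.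
  by have := gM _ s1; have := gq _ s1; have := ler_norm M; rewrite /K; lra.
have -> : y * z - peval x (p * q) =
    y * (z - peval x q) + (y - peval x p) * peval x q.
  by rewrite pevalM mulrBr mulrBl addrA subrK.
apply: le_trans (cnormD _ _) _; apply: le_trans (lerD (cnormM _ _) (cnormM _ _)) _.
apply: bound; rewrite ?cnorm_ge0 //; first by rewrite /K; lra.
rewrite -(subKr z (peval x q)) (le_trans (cnormB _ _)) //.
by rewrite /K; lra.
Qed.

Lemma fcalc_star x h y : star x = x -> fcalc x h y -> fcalc x (fun s => (h s)^*) (star y).
Proof.
move=> sx hy e e0; have [p hp yp] := hy e e0.
exists (map_poly Num.conj p) => [s s1|].
  by rewrite horner_conj_real -rmorphB cabs_conj hp.
by rewrite -star_peval // -starB cnorm_star.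
Qed.

Lemma fcalc_opp x h y : fcalc x h y -> fcalc (- x) (fun s => h (- s)) y.
Proof.
move=> hy e e0; have [p hp yp] := hy e e0.
exists (p \Po - 'X) => [s s1|].
  by rewrite horner_comp hornerN hornerX -rmorphN hp // normrN.
by rewrite peval_comp_opp opprK.
Qed.

Lemma fcalc_cnorm x h y M : star x = x -> cnorm x <= 1 ->
  (forall s, `|s| <= 1 -> cabs (h s) <= M) -> fcalc x h y -> cnorm y <= M.
Proof.
move=> sx x1 hM hy; apply/ler_addgt0Pr => e e0.
have e2 : 0 < e / 2 by rewrite divr_gt0.
have [p hp yp] := hy _ e2.
rewrite -(subrK (peval x p) y) (le_trans (cnormD _ _)) //.
have : cnorm (peval x p) <= M + e / 2.
  apply: cnorm_peval => // s s1; rewrite -(subKr (h s) p.[s%:C]).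
  by rewrite (le_trans (cabsD _ _)) // cabsN lerD ?hM ?hp.
by move: yp; lra.
Qed.

Lemma fcalc_unique x h y z : star x = x -> cnorm x <= 1 ->
  fcalc x h y -> fcalc x h z -> y = z.
Proof.
move=> sx x1 hy hz; apply/eqP; rewrite -subr_eq0; apply/eqP; apply: cnorm_eq0.
apply/eqP; rewrite eq_le cnorm_ge0 andbT.
have := fcalcD hy (fcalcZ (-1) hz); rewrite scaleN1r.
by apply: fcalc_cnorm => // s _; rewrite mulN1r subrr cabs0.
Qed.

(** Polynomials within 2^-n of [h] differ consecutively by at most 2 * 2^-n on [-1, 1]; the sup
    bound carries this to their values at [x], which form a geometric Cauchy sequence. *)
Lemma fcalc_exists x h : star x = x -> cnorm x <= 1 -> cont_on_segment h ->
  exists y, fcalc x h y.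
Proof.
move=> sx x1 ch.
have h2 n : 0 < (2^-1 : R) ^+ n by rewrite exprn_gt0 // invr_gt0.
have [p hp] := choice (fun n => weierstrass ch (h2 n)).
have [||n|l hl] := @cauchy_geometric R A (fun n => peval x (p n)) 2 2^-1.
- by rewrite invr_ge0.
- by rewrite invf_lt1 // ltr1n.
- rewrite -pevalB; apply: cnorm_peval => // s s1.
  rewrite hornerD hornerN -(subrKA (h s)) (le_trans (cabsD _ _)) //.
  rewrite cabsB mulr_natl mulr2n lerD ?hp // (le_trans (hp _ _ s1)) //.
  by rewrite exprS ler_piMl ?(ltW (h2 _)) // invf_le1 // ler1n.
exists l => e e0.
have lim : (2^-1 : R) ^+ n @[n --> \oo] --> 0.
  by apply: cvg_expr; rewrite ger0_norm ?invr_ge0 // invf_lt1 // ltr1n.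
have near_e : \forall n \near \oo, (2^-1 : R) ^+ n < e by exact: cvgr_lt lim _ e0.
have [N _ hN] := filterI near_e (hl _ e0).
have /= [N1 N2] := hN N (leqnn N).
exists (p N) => [s s1|]; first by rewrite (le_trans (hp _ _ s1)) // ltW.
by rewrite cnorm_distC ltW.
Qed.

End FunctionalCalculus.

Lemma fcalc_star_hom (R : realType) (A B : cstarAlgType R) (f : A -> B) x h y :
  unital_star_hom f -> fcalc x h y -> fcalc (f x) h (f y).
Proof.
move=> hf hy e e0; have [p hp yp] := hy e e0; exists p => //.
have -> : peval (f x) p = f (peval x p).
  rewrite !(peval_wide _ (leqnn _)).
  elim/big_rec2: _ => [|i a b _ ->]; first by rewrite (star_hom0 hf).
  by rewrite (star_homD hf) (star_homZ hf) (star_homX hf).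
by rewrite -(star_homB hf) (le_trans (star_hom_contractive hf _)).
Qed.

(** * Invertibility and norms *)

Section Positivity.
Variables (R : realType) (A : cstarAlgType R).
Implicit Types (x y z : A) (c t : R).

(* Adding [c] to [z z^*] is, up to the factor [q^2] and the exchange of [z z^*] and [z^* z],
   the same as adding [(c + 1) / q^2 - 1]; iterating, the constant exceeds the norm. *)
Lemma invertible_add_mulr_star (q : R) z c : 0 < q -> q < 1 ->
  star z * z = (1 - q ^+ 2)%:C%:A + (q ^+ 2)%:C *: (z * star z) -> 0 < c ->
  invertible (c%:C%:A + z * star z).
Proof.
move=> q0 q1 hz.
have q20 : 0 < q ^+ 2 by rewrite exprn_gt0.
have q21 : q ^+ 2 < 1 by rewrite exprn_ilt1 // ltW.
(* Factor out [b] and apply Jacobson's formula to 1 + b^-1 u v. *)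
have exchange (b : R) : 0 < b -> invertible (b%:C%:A + star z * z) ->
    invertible (b%:C%:A + z * star z).
  move=> b0 hi; have bn : b%:C != 0 by rewrite (fmorph_eq0 (real_complex R)) gt_eqF.
  have El (u v : A) : b%:C%:A + u * v = b%:C *: (1 - (- (b%:C^-1 *: u)) * v).
    by rewrite mulNr opprK scalerDr -scalerAl scalerA mulfV // scale1r.
  have Er (u v : A) : b%:C%:A + u * v = b%:C *: (1 - u * (- (b%:C^-1 *: v))).
    by rewrite mulrN opprK scalerDr -scalerAr scalerA mulfV // scale1r.
  rewrite Er; apply: invertibleZ => //; apply: invertible_1B_mulC.
  have := invertibleZ (invr_neq0 bn) hi.
  by rewrite El scalerA mulVf // scale1r.
(* The map c -> (c + 1)/q^2 - 1 multiplies c + 1 by q^-2, so (c' + 1)/q^(2n) - 1 is its n-th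
   iterate; at n = 0 the Neumann series applies. *)
have step n (c' : R) : 0 < c' -> cnorm (z * star z) < (c' + 1) / (q ^+ 2) ^+ n - 1 ->
    invertible (c'%:C%:A + z * star z).
  elim: n c' => [|n IH] c' c0 hc.
    rewrite expr0 divr1 addrK in hc.
    have cn : c'%:C != 0 by rewrite (fmorph_eq0 (real_complex R)) gt_eqF.
    apply: (@invertible_cnorm_lt _ _ c'%:C) => //.
    by rewrite opprD addrA subrr add0r cnormN cabs_real gtr0_norm.
  apply: exchange => //.
  have q2n : (q ^+ 2)%:C != 0 by rewrite (fmorph_eq0 (real_complex R)) gt_eqF.
  pose c'' := (c' + 1) / q ^+ 2 - 1.
  have -> : c'%:C%:A + star z * z = (q ^+ 2)%:C *: (c''%:C%:A + z * star z).
    rewrite hz scalerDr scalerA -rmorphM addrA -scalerDl -rmorphD.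
    by congr (_%:C *: _ + _); rewrite /c''; field; rewrite gt_eqF.
  apply: invertibleZ => //; apply: IH.
    by rewrite /c'' subr_gt0 ltr_pdivlMr // mul1r; lra.
  by rewrite /c'' subrK -mulrA -invfM -exprS.
move=> c0.
have lim : (q ^+ 2) ^+ n @[n --> \oo] --> 0 by apply: cvg_expr; rewrite gtr0_norm.
have nz := cnorm_ge0 (z * star z).
have nz1 : 0 < cnorm (z * star z) + 1 by rewrite ltr_wpDl.
have e0 : 0 < (c + 1) / (cnorm (z * star z) + 1) by rewrite divr_gt0 // addr_gt0.
have near_e : \forall n \near \oo, (q ^+ 2) ^+ n < (c + 1) / (cnorm (z * star z) + 1).
  exact: cvgr_lt lim _ e0.
have [N _ hN] := near_e.
have /= hNN := hN N (leqnn N).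
apply: (step N) => //; rewrite ltrBrDr ltr_pdivlMr ?exprn_gt0 //.
by move: hNN; rewrite ltr_pdivlMr // mulrC.
Qed.

(** 1 - u^(n+1) is 1 - u times the sum of u^j over j <= n, and each u^j is at least u^n. *)
Lemma natmul_onem_exp_le (u : R) n : 0 <= u -> u <= 1 ->
  n.+1%:R * ((1 - u) * u ^+ n) <= 1 - u ^+ n.+1.
Proof.
move=> u0 u1; elim: n => [|n IH]; first by rewrite expr0 expr1 mulr1 mul1r.
have h1 := ler_wpM2l u0 IH.
have h2 : 0 <= (1 - u) * (1 - u ^+ n.+1).
  by rewrite mulr_ge0 // subr_ge0 // exprn_ile1.
have -> : n.+2%:R * ((1 - u) * u ^+ n.+1) =
    u * (n.+1%:R * ((1 - u) * u ^+ n)) + (1 - u) * u ^+ n.+1.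
  by rewrite -(natr1 n.+1) exprS; ring.
by move: h1 h2; rewrite !exprS; move: (u ^+ n) (n.+1%:R : R) => v m; lra.
Qed.

(* With [w = 1 - y / t], the function [(1 - s) ((1 + s) / 2)^n] is O(1/n) on [-1, 1] and [1 -
   w] is invertible, so that the powers of [(1 + w) / 2] tend to 0. *)
Lemma cnorm_lt_of_invertible t y : 0 < t -> star y = y -> cnorm (t%:C%:A - y) <= t ->
  invertible y -> cnorm ((2 * t)%:C%:A - y) < 2 * t.
Proof.
move=> t0 sy yt [v [yv vy]].
have tn : t%:C != 0 by rewrite (fmorph_eq0 (real_complex R)) gt_eqF.
pose w := 1 - t^-1%:C *: y.
have tw : t%:C *: w = t%:C%:A - y.
  by rewrite scalerBr scalerA -rmorphM mulfV ?gt_eqF // rmorph1 scale1r.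
have sw : star w = w by rewrite starB star1 starZr sy.
have w1 : cnorm w <= 1.
  by move: yt; rewrite -tw cnormZc cabs_real gtr0_norm // ger_pMr.
pose q : {poly R[i]} := 2^-1 *: (1 + 'X).
have qw : peval w q = 2^-1%:C *: (1 + w) by rewrite pevalZ pevalD peval1 pevalX half_real.
have sq : star (peval w q) = peval w q by rewrite qw starZr starD star1 sw.
have -> : (2 * t)%:C%:A - y = (2 * t)%:C *: peval w q.
  rewrite qw scalerA -rmorphM mulrAC mulfV ?pnatr_eq0 // mul1r scalerDr tw.
  by rewrite addrA -scalerDl -rmorphD; congr (_%:C%:A - _); ring.
have t20 : 0 < 2 * t by rewrite mulr_gt0.
rewrite cnormZc cabs_real gtr0_norm // gtr_pMr //.
have edge n : n.+1%:R * cnorm (peval w ((1 - 'X) * q ^+ n)) <= 2.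
  rewrite mulrC -ler_pdivlMr ?ltr0n //; apply: cnorm_peval => // s s1.
  have [s0 s1'] : -1 <= s /\ s <= 1 by move: s1; rewrite ler_norml => /andP[].
  rewrite hornerM horner_exp hornerZ !hornerD hornerN hornerX !hornerC.
  pose u := (1 + s) / 2.
  have u0 : 0 <= u by rewrite /u; lra.
  have u1 : u <= 1 by rewrite /u; lra.
  have -> : (1 - s%:C) * (2^-1 * (1 + s%:C)) ^+ n = (2 * ((1 - u) * u ^+ n))%:C.
    have -> : 2^-1 * (1 + s%:C) = u%:C.
      by rewrite /u rmorphM fmorphV rmorphD rmorph1 rmorph_nat mulrC.
    have -> : 1 - s%:C = (2 * (1 - u))%:C.
      by rewrite /u -(rmorph1 (real_complex R)) -rmorphB; congr (_%:C); field.
    by rewrite -rmorphXn -rmorphM mulrA.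
  have p0 : 0 <= (1 - u) * u ^+ n by rewrite mulr_ge0 ?exprn_ge0 // subr_ge0.
  have p2 : 0 <= 2 * ((1 - u) * u ^+ n) by rewrite mulr_ge0.
  rewrite cabs_real (ger0_norm p2) ler_pdivlMr ?ltr0n //.
  have := natmul_onem_exp_le n u0 u1; have := exprn_ge0 n.+1 u0.
  by move: (u ^+ n.+1) ((1 - u) * u ^+ n) (n.+1%:R : R) => a b m; lra.
rewrite ltNge; apply/negP => m1.
have y1 : 1 - w = t^-1%:C *: y by rewrite /w opprB addrC subrK.
pose K := cnorm (t%:C *: v).
(* If q(w) had norm at least 1, so would its 2^k-th powers. But t v inverts 1 - w, so such a power
   is t v (1 - w) q(w)^(2^k), of norm at most 2K/(2^k + 1) by [edge]; this fails for large k. *)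
have big k : (2 ^ k).+1%:R <= 2 * K.
  apply: (@le_trans _ _ ((2 ^ k).+1%:R * cnorm (peval w (q ^+ (2 ^ k))))).
    by rewrite ler_peMr // pevalXn cnorm_sa_pow2 // exprn_ege1.
  have -> : peval w (q ^+ (2 ^ k)) = (t%:C *: v) * peval w ((1 - 'X) * q ^+ (2 ^ k)).
    rewrite pevalM pevalB peval1 pevalX mulrA y1 -scalerAl -scalerAr scalerA.
    by rewrite -rmorphM mulfV ?gt_eqF // rmorph1 scale1r vy mul1r.
  apply: (@le_trans _ _ (K * ((2 ^ k).+1%:R * cnorm (peval w ((1 - 'X) * q ^+ (2 ^ k)))))).
    by rewrite mulrCA ler_wpM2l // cnormM.
  by rewrite mulrC ler_wpM2r // ?cnorm_ge0.
have K0 : 0 <= 2 * K by rewrite mulr_ge0 ?cnorm_ge0.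
have := archi_boundP K0; set n := Num.Def.archi_bound _; rewrite ltNge => /negP; apply.
by apply: le_trans (big n); rewrite ler_nat ltnW // ltnS ltnW // ltn_expl.
Qed.

End Positivity.

(** * The upper bound *)

Section C0Functions.
Variable R : realType.
Implicit Types (f : R -> R[i]) (s e d : R).

(** The limit at 0 from the right glues [f] to its zero extension on the left. The points stay at
    most 1 because the extension by 0 may jump at 1. *)
Lemma C0_01_cont f s e : C0_01 f -> s <= 1 -> 0 < e ->
  exists2 d, 0 < d & forall t, t <= 1 -> `|s - t| < d -> cabs (f s - f t) <= e.
Proof.
move=> [cf f0 fz] s1 e0.
have fz' t : t <= 0 -> f t = 0 by move=> t0; apply: fz; rewrite in_itv /= ltNge t0.
have eC : (0 : R[i]) < e%:C by rewrite ltcR.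
have [s0|s0|s0] := ltgtP s 0.
- exists (- s); first by rewrite oppr_gt0.
  move=> t t1 st; rewrite !fz' ?subrr ?cabs0 ?ltW //.
  by have := ler_norm (t - s); rewrite distrC; lra.
- have /subspace_continuousP cf' := cf.
  have sI : [set` `]0, 1]] s by rewrite /= in_itv /= s0 s1.
  have /cvgrPdist_lt /(_ _ eC) [d /= d0 hd] := cf' s sI.
  exists (Num.min d s); first by rewrite lt_min d0 s0.
  move=> t t1; rewrite lt_min => /andP[td ts].
  have t0 : 0 < t by have := ler_norm (s - t); lra.
  have := hd t td; rewrite /= in_itv /= t0 t1 => /(_ isT).
  by rewrite cabsE ltcR => /ltW.
- have /cvgrPdist_lt /(_ _ eC) [d /= d0 hd] := f0.
  exists d => // t t1; rewrite s0 => td; rewrite (fz' 0) //.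
  have [t0|t0] := leP t 0; first by rewrite fz' // subrr cabs0 ltW.
  by have := hd t td t0; rewrite cabsE ltcR => /ltW.
Qed.

(* [C_0((0,1]) (x) C(Z/2)] is the algebra of functions on [-1, 1] vanishing at 0: the copies of
   (0, 1] indexed by 0 and 1 become the positive and the negative half. *)
Definition fold2 (F : 'Z_2 -> R -> R[i]) : R -> R[i] :=
  fun s => F 0 s + F 1 (- s).

Lemma cont_fold2 F : C0_tensor_CG F -> cont_on_segment (fold2 F).
Proof.
move=> hF s e; rewrite ler_norml => /andP[s0 s1] e0.
have e2 : 0 < e / 2 by rewrite divr_gt0.
have [d d0 hd] := C0_01_cont (hF 0) s1 e2.
have [|d' d'0 hd'] := C0_01_cont (s := - s) (hF 1) _ e2; first by rewrite lerNl.
exists (Num.min d d'); first by rewrite lt_min d0 d'0.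
move=> t; rewrite ler_norml => /andP[t0 t1]; rewrite lt_min => /andP[st st'].
have t0' : - t <= 1 by rewrite lerNl.
have st'' : `|- s - - t| < d' by rewrite -opprB normrN opprK addrC.
rewrite /fold2 opprD addrACA [leRHS]splitr.
apply: le_trans (cabsD _ _) _; apply: lerD; [exact: hd | exact: hd'].
Qed.

(** For every s, one of s and -s is nonpositive, where the C_0 functions vanish, so there are no
    cross terms. *)
Lemma fold2M F H s : C0_tensor_CG F -> C0_tensor_CG H ->
  fold2 (fun g x => F g x * H g x) s = fold2 F s * fold2 H s.
Proof.
move=> hF hH; rewrite /fold2.
have z (f : R -> R[i]) t : C0_01 f -> t <= 0 -> f t = 0.
  by move=> [_ _ fz] t0; apply: fz; rewrite in_itv /= ltNge t0.
have [s0|s0] := leP s 0.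
  by rewrite (z (F 0)) ?(z (H 0)) // !mul0r !add0r.
by rewrite (z (F 1)) ?(z (H 1)) ?oppr_le0 ?(ltW s0) // mulr0 !addr0.
Qed.

Lemma fold2_t s : `|s| <= 1 -> fold2 (@t_tensor_1 R 'Z_2) s = `|s|%:C.
Proof.
rewrite ler_norml => /andP[s0 s1]; rewrite /fold2 /t_tensor_1 !in_itv /=.
have [sp|sn|<-] := ltgtP 0 s.
- by rewrite s1 oppr_gt0 ltNge (ltW sp) /= addr0 gtr0_norm.
- by rewrite oppr_gt0 sn lerNl s0 add0r ltr0_norm.
- by rewrite oppr0 ltxx addr0 normr0.
Qed.

Lemma cont_normr : cont_on_segment (fun s : R => `|s|%:C).
Proof.
move=> s e _ e0; exists e => // t _ st.
by rewrite -rmorphB cabs_real (le_trans (ler_dist_dist _ _)) // ltW.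
Qed.

End C0Functions.

Section UpperBound.
Variables (R : realType) (A : cstarAlgType R) (alpha : 'Z_2 -> A -> A).
Hypothesis halpha : star_action alpha.
Implicit Types (x y z : A).

(** The functional calculus is a relation, hence the choice of a value. For a self-adjoint
    contraction [x] and [F] in [C0_tensor_CG] the value exists and is unique, and the default 0 does
    not intervene. *)
Definition odd_hom x (F : 'Z_2 -> R -> R[i]) : A := xget 0 (fcalc x (fold2 F)).

Lemma odd_homE x F y : star x = x -> cnorm x <= 1 -> fcalc x (fold2 F) y -> odd_hom x F = y.
Proof.
move=> sx x1 hy; rewrite /odd_hom; case: xgetP => [w _ hw|/(_ y)//].
exact: fcalc_unique hw hy.
Qed.

Lemma odd_homP x F : star x = x -> cnorm x <= 1 -> C0_tensor_CG F ->
  fcalc x (fold2 F) (odd_hom x F).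
Proof.
move=> sx x1 hF; have [y hy] := fcalc_exists sx x1 (cont_fold2 hF).
by rewrite (odd_homE sx x1 hy).
Qed.

Lemma odd_hom_equivariant x : star x = x -> cnorm x <= 1 -> alpha 1 x = - x ->
  equivariant_star_hom alpha (odd_hom x).
Proof.
move=> sx x1 ax; split.
- move=> F H hF hH; apply: odd_homE => //.
  apply: fcalc_eq (fcalcD (odd_homP sx x1 hF) (odd_homP sx x1 hH)) => s _.
  by rewrite /fold2 addrACA.
- move=> a F hF; apply: odd_homE => //.
  apply: fcalc_eq (fcalcZ a (odd_homP sx x1 hF)) => s _.
  by rewrite /fold2 mulrDr.
- move=> F H hF hH; apply: odd_homE => //.
  have [M M0 hM] := cont_on_segment_bounded (cont_fold2 hF).
  have [N N0 hN] := cont_on_segment_bounded (cont_fold2 hH).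
  have MN s : `|s| <= 1 -> cabs (fold2 F s) <= M + N.
    by move=> s1; rewrite (le_trans (hM _ s1)) // lerDl ltW.
  have NM s : `|s| <= 1 -> cabs (fold2 H s) <= M + N.
    by move=> s1; rewrite (le_trans (hN _ s1)) // lerDr ltW.
  apply: fcalc_eq (fcalcM MN NM (odd_homP sx x1 hF) (odd_homP sx x1 hH)) => s _.
  by rewrite fold2M.
- move=> F hF; apply: odd_homE => //.
  apply: fcalc_eq (fcalc_star sx (odd_homP sx x1 hF)) => s _.
  by rewrite /fold2 rmorphD.
- move=> g F hF; apply: odd_homE => //.
  have [->|->] : g = 0 \/ g = 1.
    by case: g => [[|[|//]]] ?; [left|right]; apply: val_inj.
  + rewrite (star_action1 halpha); apply: fcalc_eq (odd_homP sx x1 hF) => s _.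
    by rewrite /fold2 !mulg1.
  (* The generator sends h(x) to h(-x), and the reflection of [-1, 1] exchanges the two copies of
     (0, 1], which is translation by the generator. *)
  + have := fcalc_opp (fcalc_star_hom (star_action_hom halpha (1%R : 'Z_2)) (odd_homP sx x1 hF)).
    rewrite ax opprK; apply: fcalc_eq => s _; rewrite /fold2 opprK addrC.
    by congr (F _ _ + F _ _); apply: val_inj.
Qed.

(** These are |x| >= x^2 and x^2 >= 0 in norm form; they come from 0 <= |s| - s^2 <= 1 and 0 <= s^2
    <= 1 on [-1, 1]. *)
Lemma cnorm_odd_hom_t x : star x = x -> cnorm x <= 1 ->
  cnorm (1 - (odd_hom x (@t_tensor_1 R 'Z_2) - x ^+ 2)) <= 1 /\ cnorm (1 - x ^+ 2) <= 1.
Proof.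
move=> sx x1; have [y hy] := fcalc_exists sx x1 (@cont_normr R).
have -> : odd_hom x (@t_tensor_1 R 'Z_2) = y.
  by apply: odd_homE => //; apply: fcalc_eq hy => s s1; rewrite fold2_t.
have := fcalc_poly x (1 : {poly R[i]}); rewrite peval1 => h1.
have := fcalc_poly x ('X^2 : {poly R[i]}); rewrite pevalXn pevalX => h2.
have h2' := fcalcZ (-1) h2; rewrite scaleN1r in h2'.
split.
  have := fcalcD h1 (fcalcZ (-1) (fcalcD hy h2')).
  rewrite scaleN1r; apply: fcalc_cnorm => // s s1.
  rewrite hornerXn hornerC mulN1r mulN1r.
  have -> : 1 + - (`|s|%:C + - s%:C ^+ 2) = (1 - (`|s| - s ^+ 2))%:C.
    by rewrite !rmorphB rmorph1 rmorphXn.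
  rewrite cabs_real -(real_normK (num_real s)).
  have := normr_ge0 s; move: (`|s|) s1 => r r1 r0; rewrite ler_norml.
  by apply/andP; split; nra.
have := fcalcD h1 h2'.
apply: fcalc_cnorm => // s s1.
rewrite hornerXn hornerC mulN1r -rmorphXn -(rmorph1 (real_complex R)) -rmorphB cabs_real.
rewrite -(real_normK (num_real s)).
have := normr_ge0 s; move: (`|s|) s1 => r r1 r0; rewrite ler_norml.
by apply/andP; split; nra.
Qed.

Theorem WLT_le1 (q : R) z : 0 < q -> q < 1 ->
  star z * z = (1 - q ^+ 2)%:C%:A + (q ^+ 2)%:C *: (z * star z) ->
  alpha 1 z = - z -> WLT_le alpha 1.
Proof.
move=> q0 q1 hz az.
have nz := cnorm_ge0 z.
pose r := (2 * (cnorm z + 1))^-1.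
have r0 : 0 < r by rewrite invr_gt0 mulr_gt0 // ltr_wpDl.
(* Up to sign, 2r times the real and imaginary parts of [z]; [r] is small enough to make both
   contractions. *)
pose x : 'I_2 -> A := fun i =>
  if i == 0 then r%:C *: (z + star z) else (r%:C * 'i) *: (z - star z).
have conj_rI : (r%:C * 'i : R[i])^* = - (r%:C * 'i).
  by rewrite rmorphM /= conjCi mulrN; congr (- (_ * _)); exact: conj_real.
have sx i : star (x i) = x i.
  rewrite /x; case: ifP => _.
    by rewrite starZr starD starK addrC.
  by rewrite starZ conj_rI starB starK scaleNr -scalerN opprB.
have r2 : r * (2 * cnorm z) <= 1.
  by rewrite mulrC ler_pdivrMr ?mulr_gt0 ?ltr_wpDl //; lra.
have ci : cabs ('i : R[i]) = 1 by rewrite /cabs normCi.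
have x1 i : cnorm (x i) <= 1.
  rewrite /x; case: ifP => _; rewrite cnormZc ?cabsM ?ci ?mulr1 cabs_real gtr0_norm //;
    apply: le_trans r2; rewrite ler_wpM2l ?(ltW r0) // mulr_natl mulr2n.
    by rewrite (le_trans (cnormD _ _)) // cnorm_star.
  by rewrite (le_trans (cnormB _ _)) // cnorm_star.
have hom1 := star_action_hom halpha (1%R : 'Z_2).
have asz : alpha 1 (star z) = - star z by rewrite (star_homS hom1) az starN.
have ax i : alpha 1 (x i) = - x i.
  rewrite /x; case: ifP => _; rewrite (star_homZ hom1) ?(star_homB hom1) ?(star_homD hom1).
    by rewrite az asz -opprD scalerN.
  by rewrite az asz -opprD scalerN.
exists (fun i => odd_hom (x i)); split; first by move=> i; exact: odd_hom_equivariant.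
have [a0 b0] := cnorm_odd_hom_t (sx 0) (x1 0).
have [a1 b1] := cnorm_odd_hom_t (sx 1) (x1 1).
rewrite big_ord_recl big_ord1.
have -> : lift ord0 (ord0 : 'I_1) = 1 by apply: val_inj.
set y0 := odd_hom _ _ in a0 *; set y1 := odd_hom _ _ in a1 *.
pose D := x 0 ^+ 2 + x 1 ^+ 2.
pose c := (1 - q ^+ 2) / (1 + q ^+ 2).
have q2 : q ^+ 2 < 1 by rewrite exprn_ilt1 // ltW.
have q20 : 0 < q ^+ 2 by rewrite exprn_gt0.
have c0 : 0 < c by rewrite divr_gt0 ?subr_gt0 // addr_gt0.
(* The cross terms cancel: D is 2r^2 times z z^* + z^* z, which equals (1 - q^2) + (1 + q^2) z z^*
   by hypothesis; [c] is the ratio of the two coefficients. *)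
have DE : D = (2 * r ^+ 2 * (1 + q ^+ 2))%:C *: (c%:C%:A + z * star z).
  have sqD (a b : A) : (a + b) ^+ 2 = (a * a + b * b) + (a * b + b * a).
    by rewrite expr2 mulrDl !mulrDr [b * a + _]addrC addrACA.
  have sqB (a b : A) : (a - b) ^+ 2 = (a * a + b * b) - (a * b + b * a).
    by rewrite sqD mulrNN mulrN mulNr -opprD.
  rewrite /D /x /= !exprZn exprMn sqrCi mulrN1 scaleNr -scalerBr sqB sqD.
  rewrite opprB [_ + (_ - _)]addrC addrA subrK hz -mulr2n -scaler_nat.
  rewrite [z * star z + _]addrCA -{1}(scale1r (z * star z)) -scalerDl.
  have -> : (2 * r ^+ 2 * (1 + q ^+ 2))%:C = r%:C ^+ 2 * (2%:R * (1 + (q ^+ 2)%:C)).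
    have E2 : (2 : R)%:C = 2 by rewrite rmorph_nat.
    have Eq : (1 + q ^+ 2)%:C = 1 + (q ^+ 2)%:C by rewrite rmorphD rmorph1.
    have Er : (r ^+ 2)%:C = r%:C ^+ 2 by rewrite rmorphXn.
    have -> : (2 * r ^+ 2 * (1 + q ^+ 2))%:C = (2 : R)%:C * (r ^+ 2)%:C * (1 + q ^+ 2)%:C.
      by rewrite -!(rmorphM (real_complex R)).
    by rewrite E2 Eq Er; ring.
  rewrite -(scalerA (r%:C ^+ 2)) -(scalerA 2%:R); congr (_ *: (_ *: _)).
  rewrite [RHS]scalerDr scalerA; congr (_ *: _ + _).
  rewrite -(rmorph1 (real_complex R)) -rmorphD -rmorphM; congr (_%:C).
  by rewrite /c mulrC divfK // gt_eqF // addr_gt0.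
have iD : invertible D.
  rewrite DE; apply: invertibleZ; last exact: (invertible_add_mulr_star q0 q1 hz c0).
  by rewrite (fmorph_eq0 (real_complex R)) gt_eqF // !mulr_gt0 ?exprn_gt0 // addr_gt0.
have sD : star D = D by rewrite starD !starX !sx.
have two : (2 : R)%:C%:A = 1 + 1 :> A by rewrite rmorphD scalerDl rmorph1 scale1r.
have D2 : cnorm ((2 : R)%:C%:A - D) <= 2.
  by rewrite two opprD addrACA (le_trans (cnormD _ _)) // lerD.
(* Invertibility of [D] gives a strict bound around 4. The two differences |x_i| - x_i^2 each lie
   within 1 of 1, so the whole sum is strictly within 6 of 6. *)
have D4 := cnorm_lt_of_invertible (ltr0n _ 2) sD D2 iD.
have n6 : (6 : R)%:C != 0 by rewrite (fmorph_eq0 (real_complex R)) pnatr_eq0.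
apply: (invertible_cnorm_lt n6).
have -> : (6 : R)%:C%:A - (y0 + y1) =
    ((2 * 2 : R)%:C%:A - D) + ((1 - (y0 - x 0 ^+ 2)) + (1 - (y1 - x 1 ^+ 2))).
  have -> : (6 : R)%:C%:A = (2 * 2 : R)%:C%:A + (1 + 1) :> A.
    by rewrite -two -scalerDl -rmorphD; congr (_%:C%:A); ring.
  rewrite [1 - _ + _]addrACA -opprD [y0 - _ + _]addrACA -opprD -/D opprB.
  by rewrite [1 + 1 + (D - _)]addrCA [RHS]addrA subrK [RHS]addrA.
rewrite cabs_real gtr0_norm // (le_lt_trans (cnormD _ _)) //.
have := le_trans (cnormD _ _) (lerD a0 a1).
by move: D4; lra.
Qed.

End UpperBound.

(** * Bounded continuous functions on the line *)

Section BoundedContinuous.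
Variable R : realType.
Implicit Types (s t e d M : R).

(** The line, as the cover of the circle, serves as test space: the antipode becomes translation by
    pi, and boundedness makes the sup norm finite. *)
Definition bounded_cont (f : R -> R[i]) : Prop :=
  (forall s e, 0 < e ->
     exists2 d, 0 < d & forall t, `|s - t| < d -> cabs (f s - f t) <= e) /\
  (exists M, forall s, cabs (f s) <= M).

Record bcfun := BCFun { bcval :> R -> R[i]; bcvalP : `[< bounded_cont bcval >] }.

HB.instance Definition _ := [isSub for bcval].
HB.instance Definition _ := [Choice of bcfun by <:].

Implicit Types f g h : bcfun.

Lemma bcfun_ext f g : (forall s, f s = g s) -> f = g.
Proof. by move=> fg; apply: val_inj; apply/funext. Qed.

Lemma bounded_contP f : bounded_cont f.
Proof. by case: f => f /= /asboolP. Qed.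

Definition mkbc (f : R -> R[i]) (hf : bounded_cont f) : bcfun := BCFun (asboolT hf).

Lemma bounded_cont_cst (c : R[i]) : bounded_cont (fun=> c).
Proof.
split; last by exists (cabs c).
by move=> s e e0; exists 1 => // t _; rewrite subrr cabs0 ltW.
Qed.

Lemma bounded_contD f g : bounded_cont (fun s => f s + g s).
Proof.
have [cf [M hM]] := bounded_contP f; have [cg [N hN]] := bounded_contP g.
split; last by exists (M + N) => s; rewrite (le_trans (cabsD _ _)) // lerD.
move=> s e e0; have e2 : 0 < e / 2 by rewrite divr_gt0.
have [d d0 hd] := cf s _ e2; have [d' d'0 hd'] := cg s _ e2.
exists (Num.min d d'); first by rewrite lt_min d0.
move=> t; rewrite lt_min => /andP[td td']; rewrite opprD addrACA [leRHS]splitr.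
by apply: le_trans (cabsD _ _) _; apply: lerD; [exact: hd | exact: hd'].
Qed.

Lemma bounded_contM f g : bounded_cont (fun s => f s * g s).
Proof.
have [cf [M hM]] := bounded_contP f; have [cg [N hN]] := bounded_contP g.
have M0 : 0 <= M := le_trans (cabs_ge0 _) (hM 0).
have N0 : 0 <= N := le_trans (cabs_ge0 _) (hN 0).
split; last by exists (M * N) => s; rewrite cabsM ler_pM ?cabs_ge0.
move=> s e e0.
have K0 : 0 < M + N + 1 by rewrite ltr_wpDl // addr_ge0.
have e2 : 0 < e / (M + N + 1) by rewrite divr_gt0.
have [d d0 hd] := cf s _ e2; have [d' d'0 hd'] := cg s _ e2.
exists (Num.min d d'); first by rewrite lt_min d0.
move=> t; rewrite lt_min => /andP[td td'].
have -> : f s * g s - f t * g t = f s * (g s - g t) + (f s - f t) * g t by ring.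
have h1 := hd t td; have h2 := hd' t td'.
apply: le_trans (cabsD _ _) _; rewrite !cabsM.
apply: (@le_trans _ _ (M * (e / (M + N + 1)) + (e / (M + N + 1)) * N)).
  by rewrite lerD // ler_pM ?cabs_ge0.
have -> : M * (e / (M + N + 1)) + e / (M + N + 1) * N = (M + N) * e / (M + N + 1).
  by ring.
by rewrite ler_pdivrMr // mulrC ler_wpM2l ?(ltW e0) // lerDl.
Qed.

Lemma bounded_cont_conj f : bounded_cont (fun s => (f s)^*).
Proof.
have [cf [M hM]] := bounded_contP f.
split; last by exists M => s; rewrite cabs_conj.
move=> s e e0; have [d d0 hd] := cf s _ e0; exists d => // t td.
by rewrite -rmorphB cabs_conj hd.
Qed.

Lemma bounded_cont_shift f c : bounded_cont (fun s => f (s + c)).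
Proof.
have [cf [M hM]] := bounded_contP f.
split; last by exists M => s.
move=> s e e0; have [d d0 hd] := cf (s + c) _ e0; exists d => // t td.
by apply: hd; rewrite opprD addrACA subrr addr0.
Qed.

Definition bc_cst c := mkbc (bounded_cont_cst c).
Definition bc_add f g := mkbc (bounded_contD f g).
Definition bc_mul f g := mkbc (bounded_contM f g).
Definition bc_scale c f := bc_mul (bc_cst c) f.
Definition bc_opp f := bc_scale (-1) f.
Definition bc_star f := mkbc (bounded_cont_conj f).

Lemma bc_addA : associative bc_add.
Proof. by move=> f g h; apply: bcfun_ext => s /=; rewrite addrA. Qed.
Lemma bc_addC : commutative bc_add.
Proof. by move=> f g; apply: bcfun_ext => s /=; rewrite addrC. Qed.
Lemma bc_add0 : left_id (bc_cst 0) bc_add.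
Proof. by move=> f; apply: bcfun_ext => s /=; rewrite add0r. Qed.
Lemma bc_addN : left_inverse (bc_cst 0) bc_opp bc_add.
Proof. by move=> f; apply: bcfun_ext => s /=; rewrite mulN1r addNr. Qed.

HB.instance Definition _ := GRing.isZmodule.Build bcfun bc_addA bc_addC bc_add0 bc_addN.

Lemma bc_mulA : associative bc_mul.
Proof. by move=> f g h; apply: bcfun_ext => s /=; rewrite mulrA. Qed.
Lemma bc_mulC : commutative bc_mul.
Proof. by move=> f g; apply: bcfun_ext => s /=; rewrite mulrC. Qed.
Lemma bc_mul1 : left_id (bc_cst 1) bc_mul.
Proof. by move=> f; apply: bcfun_ext => s /=; rewrite mul1r. Qed.
Lemma bc_mulDl : left_distributive bc_mul bc_add.
Proof. by move=> f g h; apply: bcfun_ext => s /=; rewrite mulrDl. Qed.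
Lemma bc_1neq0 : bc_cst 1 != bc_cst 0.
Proof.
by apply/eqP => /(congr1 (fun f : bcfun => f 0)) /= /eqP; rewrite oner_eq0.
Qed.

HB.instance Definition _ := GRing.Zmodule_isComNzRing.Build bcfun
  bc_mulA bc_mulC bc_mul1 bc_mulDl bc_1neq0.

Lemma bc_scaleA a b f : bc_scale a (bc_scale b f) = bc_scale (a * b) f.
Proof. by apply: bcfun_ext => s /=; rewrite mulrA. Qed.
Lemma bc_scale1 : left_id 1 bc_scale.
Proof. by move=> f; apply: bcfun_ext => s /=; rewrite mul1r. Qed.
Lemma bc_scaleDr : right_distributive bc_scale +%R.
Proof. by move=> a f g; apply: bcfun_ext => s /=; rewrite mulrDr. Qed.
Lemma bc_scaleDl f : {morph bc_scale^~ f : a b / a + b}.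
Proof. by move=> a b; apply: bcfun_ext => s /=; rewrite mulrDl. Qed.

HB.instance Definition _ := GRing.Zmodule_isLmodule.Build R[i] bcfun
  bc_scaleA bc_scale1 bc_scaleDr bc_scaleDl.

Lemma bc_scaleAl (a : R[i]) f g : a *: (f * g) = a *: f * g.
Proof. by apply: bcfun_ext => s /=; rewrite mulrA. Qed.

HB.instance Definition _ := GRing.Lmodule_isLalgebra.Build R[i] bcfun bc_scaleAl.
HB.instance Definition _ := GRing.Lalgebra_isComAlgebra.Build R[i] bcfun.

Lemma bcD f g s : (f + g) s = f s + g s. Proof. by []. Qed.
Lemma bcM f g s : (f * g) s = f s * g s. Proof. by []. Qed.
Lemma bcZ (a : R[i]) f s : (a *: f) s = a * f s. Proof. by []. Qed.
Lemma bcN f s : (- f) s = - f s. Proof. exact: mulN1r. Qed.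
Lemma bcB f g s : (f - g) s = f s - g s. Proof. by rewrite bcD bcN. Qed.

Definition bc_norm f : R := sup [set cabs (f s) | s in [set: R]].

Lemma bc_norm_ge f s : cabs (f s) <= bc_norm f.
Proof.
have [_ [M hM]] := bounded_contP f.
apply: ub_le_sup; last by exists s.
by exists M => _ [t _ <-].
Qed.

Lemma bc_norm_le f M : (forall s, cabs (f s) <= M) -> bc_norm f <= M.
Proof.
move=> hM; apply: sup_le_ub; first by exists (cabs (f 0)), 0.
by move=> _ [t _ <-].
Qed.

Lemma bc_norm_ge0 f : 0 <= bc_norm f.
Proof. exact: le_trans (cabs_ge0 _) (bc_norm_ge f 0). Qed.

Lemma bc_starK : involutive bc_star.
Proof. by move=> f; apply: bcfun_ext => s /=; rewrite conjCK. Qed.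
Lemma bc_starD : {morph bc_star : f g / f + g}.
Proof. by move=> f g; apply: bcfun_ext => s /=; rewrite rmorphD. Qed.
Lemma bc_starZ (a : R[i]) f : bc_star (a *: f) = a^* *: bc_star f.
Proof. by apply: bcfun_ext => s /=; rewrite rmorphM. Qed.
Lemma bc_starM f g : bc_star (f * g) = bc_star g * bc_star f.
Proof. by apply: bcfun_ext => s /=; rewrite rmorphM mulrC. Qed.
Lemma bc_norm_eq0 f : bc_norm f = 0 -> f = 0.
Proof.
move=> f0; apply: bcfun_ext => s; apply: cabs_eq0; apply/eqP.
by rewrite eq_le cabs_ge0 andbT -f0 bc_norm_ge.
Qed.
Lemma bc_normD f g : bc_norm (f + g) <= bc_norm f + bc_norm g.
Proof.
apply: bc_norm_le => s; rewrite bcD (le_trans (cabsD _ _)) //.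
by rewrite lerD ?bc_norm_ge.
Qed.
Lemma bc_normM f g : bc_norm (f * g) <= bc_norm f * bc_norm g.
Proof.
by apply: bc_norm_le => s; rewrite bcM cabsM ler_pM ?cabs_ge0 ?bc_norm_ge.
Qed.
Lemma bc_normZ (a : R[i]) f : bc_norm (a *: f) = complex.Re `|a| * bc_norm f.
Proof.
rewrite -/(cabs a); apply/eqP; rewrite eq_le; apply/andP; split.
  by apply: bc_norm_le => s; rewrite bcZ cabsM ler_wpM2l ?cabs_ge0 ?bc_norm_ge.
have [->|a0] := eqVneq a 0; first by rewrite cabs0 mul0r bc_norm_ge0.
have ca : 0 < cabs a by rewrite -ltcR -cabsE normr_gt0.
rewrite mulrC -ler_pdivlMr //; apply: bc_norm_le => s.
by rewrite ler_pdivlMr // mulrC -cabsM -bcZ bc_norm_ge.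
Qed.
Lemma bc_norm_starM f : bc_norm (bc_star f * f) = bc_norm f ^+ 2.
Proof.
have cc s : cabs ((bc_star f * f) s) = cabs (f s) ^+ 2.
  by rewrite bcM cabsM cabs_conj expr2.
apply/eqP; rewrite eq_le; apply/andP; split.
  by apply: bc_norm_le => s; rewrite cc ler_pXn2r ?nnegrE ?cabs_ge0 ?bc_norm_ge0 ?bc_norm_ge.
have n0 := bc_norm_ge0 (bc_star f * f).
rewrite -[leRHS]sqr_sqrtr // ler_pXn2r ?nnegrE ?sqrtr_ge0 ?bc_norm_ge0 //.
apply: bc_norm_le => s; rewrite -(ger0_norm (cabs_ge0 (f s))) -sqrtr_sqr.
by rewrite ler_wsqrtr // -cc bc_norm_ge.
Qed.

Lemma real_cauchy_cvg (u : nat -> R) :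
  (forall e, 0 < e -> \forall N \near \oo, forall n, (N <= n)%N -> `|u N - u n| < e) ->
  exists l, forall e, 0 < e -> \forall n \near \oo, `|u n - l| < e.
Proof.
move=> hu.
have cu : cauchy (u @ \oo).
  apply: cauchy_exP => e e0; have [N _ hN] := hu e e0.
  by exists (u N); exists N => // n /= Nn; apply: (hN N (leqnn N)).
exists (lim (u @ \oo)) => e e0.
have /cvgrPdist_lt /(_ e e0) : u @ \oo --> lim (u @ \oo) by exact: cauchy_cvg.
by apply: filterS => n; rewrite distrC.
Qed.

Lemma bc_norm_complete (u : nat -> bcfun) :
  (forall e, 0 < e -> \forall N \near \oo, forall m n,
     (N <= m)%N -> (N <= n)%N -> bc_norm (u m - u n) < e) ->
  exists l, forall e, 0 < e -> \forall n \near \oo, bc_norm (u n - l) < e.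
Proof.
move=> hu.
have hus e : 0 < e -> exists N : nat, forall n m s, (N <= n)%N -> (N <= m)%N ->
    cabs (u n s - u m s) < e.
  move=> e0; have [N _ hN] := hu e e0; exists N => n m s Nn Nm.
  rewrite -bcB (le_lt_trans (bc_norm_ge _ _)) //.
  exact: hN (leqnn N) _ _ Nn Nm.
have lim_part (p : R[i] -> R) : (forall a b, `|p a - p b| <= cabs (a - b)) ->
    forall s, exists l, forall e, 0 < e -> \forall n \near \oo, `|p (u n s) - l| < e.
  move=> hp s; apply: real_cauchy_cvg => e e0; have [N hN] := hus e e0.
  exists N => // k /= Nk n kn; rewrite (le_lt_trans (hp _ _)) // hN //.
  exact: leq_trans kn.
have pRe (a b : R[i]) : `|complex.Re a - complex.Re b| <= cabs (a - b).
  by rewrite -raddfB Re_le_cabs.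
have pIm (a b : R[i]) : `|complex.Im a - complex.Im b| <= cabs (a - b).
  by rewrite -raddfB Im_le_cabs.
have [lr hr] := choice (lim_part _ pRe).
have [li hi] := choice (lim_part _ pIm).
pose l s : R[i] := lr s +i* li s.
have near_l s e : 0 < e -> \forall n \near \oo, cabs (u n s - l s) < e.
  move=> e0; have e2 : 0 < e / 2 by rewrite divr_gt0.
  apply: filterS2 (hr s _ e2) (hi s _ e2) => n h1 h2.
  by rewrite (le_lt_trans (cabs_le_ReIm _)) // !raddfB [ltRHS]splitr ltrD.
(* The pointwise limit is uniform: at each s compare with a later index, chosen depending on s,
   while [N] comes from the sup norm alone. *)
have unif e : 0 < e -> exists N : nat, forall n s, (N <= n)%N -> cabs (u n s - l s) <= e.
  move=> e0; have [N hN] := hus e e0; exists N => n s Nn.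
  apply/ler_addgt0Pr => e' e'0; have [N' _ hN'] := near_l s e' e'0.
  have /= h2 := hN' (maxn N N') (leq_maxr _ _).
  rewrite -(subrKA (u (maxn N N') s)) (le_trans (cabsD _ _)) // lerD ?ltW //.
  by apply: hN => //; exact: leq_maxl.
have bl : bounded_cont l.
  split; last first.
    have [N hN] := unif 1 ltr01; have [_ [M hM]] := bounded_contP (u N).
    exists (1 + M) => s; rewrite -(subrK (u N s) (l s)).
    by rewrite (le_trans (cabsD _ _)) // lerD // cabsB hN.
  move=> s e e0; have e3 : 0 < e / 3 by rewrite divr_gt0.
  have [N hN] := unif _ e3; have [cN _] := bounded_contP (u N).
  have [d d0 hd] := cN s _ e3; exists d => // t td.
  have h1 := hN N s (leqnn N); have h2 := hN N t (leqnn N); have h3 := hd t td.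
  have -> : l s - l t = (l s - u N s) + ((u N s - u N t) + (u N t - l t)) by ring.
  rewrite (le_trans (cabsD _ _)) // cabsB.
  by have := cabsD (u N s - u N t) (u N t - l t); move: h1 h2 h3; lra.
exists (mkbc bl) => e e0; have e2 : 0 < e / 2 by rewrite divr_gt0.
have [N hN] := unif _ e2; exists N => // n /= Nn.
apply: (@le_lt_trans _ _ (e / 2)); last by rewrite ltr_pdivrMr // ltr_pMr // ltr1n.
by apply: bc_norm_le => s; rewrite bcB hN.
Qed.

HB.instance Definition _ := isCStarAlgebra.Build R bcfun bc_starK bc_starD bc_starZ
  bc_starM bc_norm_eq0 bc_normD bc_normZ bc_normM bc_norm_starM bc_norm_complete.

End BoundedContinuous.

(** * The lower bound *)

Section Circle.
Variable R : realType.
Implicit Types s t e : R.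

Lemma bounded_cont_expi : bounded_cont (fun s : R => cos s +i* sin s).
Proof.
have c1 s : cabs (cos s +i* sin s) = 1.
  by rewrite /cabs normc_def /= cos2Dsin2 sqrtr1.
split; last by exists 1 => s; rewrite c1.
move=> s e e0; have e2 : 0 < e / 2 by rewrite divr_gt0.
have /cvgrPdist_lt /(_ _ e2) nc := @continuous_cos R s.
have /cvgrPdist_lt /(_ _ e2) ns := @continuous_sin R s.
have [d /= d0 hd] := filterI nc ns.
exists d => // t td; have [h1 h2] := hd t td.
apply: le_trans (cabs_le_ReIm _) _ => /=.
by rewrite [leRHS]splitr lerD // ltW.
Qed.

Definition expi : bcfun R := mkbc bounded_cont_expi.

Lemma expi_unitary : expi * star expi = 1.
Proof.
apply: bcfun_ext => s; rewrite bcM /=; apply/eqP; rewrite eq_complex /=.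
rewrite mulrN opprK -!expr2 cos2Dsin2 eqxx /=.
by rewrite mulrN mulrC addNr.
Qed.

Definition bc_shift (c : R) (f : bcfun R) : bcfun R := mkbc (bounded_cont_shift f c).

Lemma bc_shift_hom c : unital_star_hom (bc_shift c).
Proof. by split; [move=> a f g | | move=> f g | move=> f]; apply: bcfun_ext. Qed.

Lemma bc_shift_pi_expi : bc_shift pi expi = - expi.
Proof.
apply: bcfun_ext => s; rewrite bcN /=; apply/eqP.
by rewrite cosDpi sinDpi eq_complex /= !eqxx.
Qed.

(** The function is real and takes opposite values at 0 and pi, so the intermediate value theorem
    applies on [0, pi]. *)
Lemma bcfun_odd_zero (f : bcfun R) :
  (forall s, (f s)^* = f s) -> (forall s, f (s + pi) = - f s) -> exists s, f s = 0.
Proof.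
move=> fr fo; pose r s := complex.Re (f s).
have fE s : f s = (r s)%:C.
  have := fr s; rewrite /r; case: (f s) => a b /eqP.
  rewrite eq_complex /= eqxx /= eq_sym -addr_eq0 -mulr2n mulrn_eq0 /= => /eqP ->.
  by [].
have cr : continuous r.
  move=> s; apply/cvgrPdist_le => e e0; have [cf _] := bounded_contP f.
  have [d d0 hd] := cf s e e0; exists d => //= t td.
  by rewrite -cabs_real rmorphB /= -!fE hd.
have rpi : r pi = - r 0 by rewrite /r -[pi]add0r fo raddfN.
have [c _ rc] : exists2 c, c \in `[0, pi] & r c = 0.
  apply: IVT; first exact: pi_ge0.
    exact: continuous_subspaceT.
  by rewrite rpi ge_min le_max; case: (leP 0 (r 0)) => h; rewrite ?oppr_le0 ?oppr_ge0 ?h ?orbT //= ltW.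
by exists c; rewrite fE rc.
Qed.

End Circle.

Section LowerBound.
Variables (R : realType) (A : cstarAlgType R) (alpha : 'Z_2 -> A -> A).

Lemma t_tensor_1_C0 (G : finGroupType) : C0_tensor_CG (@t_tensor_1 R G).
Proof.
move=> g; rewrite /t_tensor_1.
(* In the order of [R[i]] a positive number is real, so each epsilon may be taken in [R]. *)
have posC (e : R[i]) : 0 < e -> exists2 r : R, 0 < r & e = r%:C.
  case: e => a b; rewrite ltcE /= => /andP[/eqP -> a0]; by exists a.
split.
- apply/subspace_continuousP => s sI; apply/cvgrPdist_lt => e /posC[r r0 ->].
  have {}sI : s \in `]0, 1] by exact: sI.
  exists r => // t st tI; have {}tI : t \in `]0, 1] by exact: tI.
  change (`|(if s \in `]0, 1] then s%:C else 0) - (if t \in `]0, 1] then t%:C else 0)| < r%:C).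
  by rewrite sI tI -rmorphB cabsE cabs_real ltcR.
- apply/cvgrPdist_lt => e /posC[r r0 ->].
  exists r => //= t st t0; case: ifP => _; last by rewrite subrr normr0 ltcR.
  by rewrite sub0r normrN cabsE cabs_real ltcR; move: st; rewrite /= sub0r normrN.
- by move=> s /negbTE ->.
Qed.

Lemma not_WLT_le0 (f : A -> bcfun R) : unital_star_hom f ->
  (forall a, f (alpha 1 a) = bc_shift pi (f a)) -> ~ WLT_le alpha 0.
Proof.
move=> hf fa [rho [hrho]]; rewrite big_ord1.
have [rD rZ rM rS rG] := hrho ord0; set T := rho _ _ => iT.
(* [t] tensored with the sign character: self-adjoint, odd under translation, with the same square
   as [t_tensor_1]. Hence [x] is self-adjoint and odd, with x^2 = T^2. *)
pose F : 'Z_2 -> R -> R[i] := fun g s => (if g == 0 then 1 else - 1) * @t_tensor_1 R 'Z_2 g s.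
have tC0 := @t_tensor_1_C0 'Z_2.
have C0N (h : R -> R[i]) : C0_01 h -> C0_01 (fun s => - 1 * h s).
  move=> [h1 h2 h3]; split.
  - have /subspace_continuousP h1' := h1; apply/subspace_continuousP => s sI.
    apply/cvgrPdist_lt => e e0; have /cvgrPdist_lt /(_ e e0) := h1' s sI.
    apply: filterS => t hst; change (`|- 1 * h s - - 1 * h t| < e).
    by rewrite -mulrBr normrM normrN1 mul1r; exact: hst.
  - apply/cvgrPdist_lt => e e0; have /cvgrPdist_lt /(_ e e0) := h2.
    by apply: filterS => t; rewrite mulN1r !sub0r !normrN.
  - by move=> s sI; rewrite h3 // mulr0.
have FC0 : C0_tensor_CG F.
  move=> g; rewrite /F; case: (g == 0); last exact: C0N (tC0 g).
  have -> : (fun s => 1 * t_tensor_1 g s) = @t_tensor_1 R 'Z_2 g.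
    by apply/funext => s; rewrite mul1r.
  exact: tC0.
have tr g s : (@t_tensor_1 R 'Z_2 g s)^* = t_tensor_1 g s.
  by rewrite /t_tensor_1; case: ifP => _; rewrite ?conj_real ?rmorph0.
pose x := rho ord0 F.
have xx : x * x = T * T.
  rewrite -rM // -rM //; congr (rho _ _); apply/funext => g; apply/funext => s.
  by rewrite /F mulrACA; case: ifP => _; rewrite ?mulrNN !mul1r.
have sx : star x = x.
  rewrite -rS //; congr (rho _ _); apply/funext => g; apply/funext => s.
  by rewrite /F rmorphM /= tr; case: ifP => _; rewrite ?rmorphN rmorph1.
have ax : alpha 1 x = - x.
  rewrite -rG // -scaleN1r -rZ //; congr (rho _ _); apply/funext => g; apply/funext => s.
  rewrite /F mulrA; congr (_ * _).
  by case: g => [[|[|//]]] ?; rewrite ?mulr1 ?mulrNN ?mulr1.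
have [||s fs] := @bcfun_odd_zero R (f x).
- by move=> s; rewrite -[in RHS]sx (star_homS hf).
- by move=> s; have := congr1 (fun h : bcfun R => h s) (fa x); rewrite ax (star_homN hf) bcN => ->.
have [y [Ty _]] := star_hom_invertible hf iT.
have : (f T * f T) s = 0 by rewrite -(star_homM hf) -xx (star_homM hf) bcM fs mul0r.
move=> h; have : (f T * f T * (y * y)) s = 1.
  by rewrite mulrACA Ty mulr1.
by rewrite bcM h mul0r => /eqP; rewrite eq_sym oner_eq0.
Qed.

End LowerBound.

(** * Quantum spheres *)

Section Spheres.
Variables (R : realType) (q : R).

Lemma VS_relations_hom n (A B : cstarAlgType R) (z : 'I_n -> A) (f : A -> B) :
  unital_star_hom f -> VS_relations q z -> VS_relations q (f \o z).
Proof.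
move=> hf [h1 h2 h3 h4].
have fsum (P : pred 'I_n) (F : 'I_n -> A) :
    f (\sum_(i < n | P i) F i) = \sum_(i < n | P i) f (F i).
  by elim/big_rec2: _ => [|i a b _ <-]; rewrite ?(star_hom0 hf) // (star_homD hf).
have fzz i : f (z i) * star (f (z i)) = f (z i * star (z i)).
  by rewrite -(star_homS hf) -(star_homM hf).
split=> [i j ij|i j ij|i|] /=.
- by rewrite -!(star_homM hf) h1 // (star_homZ hf).
- by rewrite -!(star_homS hf) -!(star_homM hf) h2 // (star_homZ hf).
- under eq_bigr do rewrite fzz.
  rewrite fzz -fsum -(star_homS hf) -(star_homM hf) h3.
  by rewrite (star_homD hf) (star_homZ hf).
- under eq_bigr do rewrite fzz.
  by rewrite -fsum h4 (star_hom1 hf).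
Qed.

Lemma VS_star_mul0 n (A : cstarAlgType R) (z : 'I_n.+1 -> A) : VS_relations q z ->
  star (z 0) * z 0 = (1 - q ^+ 2)%:C%:A + (q ^+ 2)%:C *: (z 0 * star (z 0)).
Proof.
case=> _ _ hn hs; rewrite (hn 0).
have -> : \sum_(j < n.+1 | (0 < j)%N) z j * star (z j) = 1 - z 0 * star (z 0).
  rewrite -hs big_ord_recl /= [RHS]addrAC subrr add0r big_mkcond big_ord_recl /= add0r.
  by [].
rewrite scalerBr addrCA; congr (_ + _).
rewrite -{1}(scale1r (z 0 * _)) -scalerBl -(rmorph1 (real_complex R)) -rmorphB.
by congr (_%:C *: _); ring.
Qed.

Definition circle_point n : 'I_n.+1 -> bcfun R := fun i => if i == 0 then expi R else 0.

(** Each commutation relation involves two distinct generators, one of which is 0, and the sum over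
    j > i runs over vanishing generators only. *)
Lemma VS_circle_point n : VS_relations q (@circle_point n).
Proof.
have nz (i : 'I_n.+1) : i != 0 -> circle_point i = 0.
  by rewrite /circle_point => /negbTE ->.
have gt0 (i j : 'I_n.+1) : (i < j)%N -> j != 0.
  by move=> ij; apply: contraTneq ij => ->; rewrite ltn0.
split=> [i j ij|i j ij|i|].
- by rewrite (nz j) ?(gt0 i) // mul0r mulr0 scaler0.
- have [j0|/nz ->] := eqVneq j 0; last by rewrite star0 mul0r mulr0 scaler0.
  by rewrite (nz i) -?j0 // mul0r mulr0 scaler0.
- rewrite big1 ?scaler0 ?addr0 1?mulrC // => j ij.
  by rewrite (nz j) ?(gt0 i) // mul0r.
- rewrite big_ord_recl big1 ?addr0; last by move=> i _; rewrite nz // mul0r.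
  exact: expi_unitary.
Qed.

(** The kernel of [f] is an ideal, closed because [f] is contractive, so it contains the kernel of
    [p]. Composing [f] with a set-theoretic section of [p] then gives the induced homomorphism. *)
Lemma quotient_by_descend (A B C : cstarAlgType R) (S : set A) (p : A -> B) (f : A -> C) :
  quotient_by S p -> unital_star_hom f -> (forall x, S x -> f x = 0) ->
  exists2 g : B -> C, unital_star_hom g & forall x, g (p x) = f x.
Proof.
move=> [hp sp kp] hf fS; have [s hs] := choice sp.
have sub : smallest (@closed_ideal R A) S `<=` [set x | f x = 0].
  apply: smallest_sub => //; split.
  - exact: star_hom0.
  - by move=> a b /= fa fb; rewrite (star_homD hf) fa fb addr0.
  - by move=> a b /= fb; rewrite (star_homM hf) fb mulr0.
  - by move=> a b /= fb; rewrite (star_homM hf) fb mul0r.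
  - move=> a ha /=; apply: cnorm_le_eps0 => e e0; have [b fb ab] := ha e e0.
    rewrite -(subr0 (f a)) -[X in f a - X]fb -(star_homB hf).
    by rewrite (le_trans (star_hom_contractive hf _)) // ltW.
have kf x : p x = 0 -> f x = 0 by move=> px; apply: sub; rewrite -kp.
have fE x y : p x = p y -> f x = f y.
  move=> pxy; apply/eqP; rewrite -subr_eq0 -(star_homB hf); apply/eqP/kf.
  by rewrite (star_homB hp) pxy subrr.
exists (f \o s) => [|x]; last by apply: fE; rewrite hs.
split=> /=.
- move=> a x y; rewrite -(star_homZ hf) -(star_homD hf); apply: fE.
  by rewrite hs (star_homD hp) (star_homZ hp) !hs.
- by rewrite -(star_hom1 hf); apply: fE; rewrite hs (star_hom1 hp).
- by move=> x y /=; rewrite -(star_homM hf); apply: fE; rewrite (star_homM hp) !hs.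
- by move=> x /=; rewrite -(star_homS hf); apply: fE; rewrite (star_homS hp) !hs.
Qed.

Lemma odd_qsphere_hom_unique n (A B : cstarAlgType R) (z : 'I_n -> A) (f g : A -> B) :
  odd_qsphere q z -> unital_star_hom f -> unital_star_hom g ->
  (forall i, f (z i) = g (z i)) -> forall x, f x = g x.
Proof.
move=> [rz uz] hf hg fg x; have [h [_ hu]] := uz _ _ (VS_relations_hom hf rz).
rewrite -(hu f); last by split.
by rewrite -(hu g) //; split=> // i; rewrite /= fg.
Qed.

Lemma qsphere_relations k (A : cstarAlgType R) (z : 'I_k./2.+1 -> A) :
  qsphere q z -> VS_relations q z.
Proof.
rewrite /qsphere; case: ifP => _; first by case.
move=> [B [w [p [[rw _] [hp _ _] pw]]]].
have -> : z = p \o w by apply/funext => i; rewrite /= pw.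
exact: VS_relations_hom.
Qed.

Lemma qsphere_hom_unique k (A B : cstarAlgType R) (z : 'I_k./2.+1 -> A) (f g : A -> B) :
  qsphere q z -> unital_star_hom f -> unital_star_hom g ->
  (forall i, f (z i) = g (z i)) -> forall x, f x = g x.
Proof.
rewrite /qsphere; case: ifP => _; first exact: odd_qsphere_hom_unique.
move=> [C [w [p [ow [hp sp _] pw]]]] hf hg fg x.
have [y <-] := sp x.
apply: (odd_qsphere_hom_unique ow (unital_star_hom_comp hp hf)
  (unital_star_hom_comp hp hg)) => i /=.
by rewrite pw fg.
Qed.

Lemma qsphere_circle_hom k (A : cstarAlgType R) (z : 'I_k./2.+1 -> A) : (0 < k)%N ->
  qsphere q z ->
  exists2 f : A -> bcfun R, unital_star_hom f & forall i, f (z i) = circle_point i.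
Proof.
move=> k0; rewrite /qsphere; case: ifP => ok.
  move=> [_ uz]; have [f [[hf fz] _]] := uz _ _ (@VS_circle_point k./2).
  by exists f.
move=> [B [w [p [[_ uw] qp pw]]]].
have [f [[hf fw] _]] := uw _ _ (@VS_circle_point k./2).
(* For even k >= 2 the last generator is not the first one, so it goes to 0, and the relation making
   it self-adjoint holds in the target. *)
have max0 : (ord_max : 'I_k./2.+1) != 0.
  apply/eqP => /(congr1 val) /= k20.
  by have := odd_double_half k; rewrite ok k20 => e; rewrite -e in k0.
have [|g hg gp] := quotient_by_descend qp hf.
  move=> _ ->; rewrite (star_homB hf) (star_homS hf) fw /circle_point (negbTE max0).
  by rewrite star0 subrr.
by exists g => // i; rewrite -pw gp fw.
Qed.

End Spheres.

Theorem proposition5p16 (R : realType) (q : R) (hq0 : 0 < q) (hq1 : q < 1)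
    (k : nat) (hk : (1 <= k)%N)
    (A : cstarAlgType R) (z : 'I_k./2.+1 -> A) (hA : qsphere q z)
    (alpha : 'Z_2 -> A -> A) (halpha : antipodal_action z alpha) :
  dim_WLT alpha = 1%E.
Proof.
have [act az] := halpha.
have le1 : WLT_le alpha 1.
  exact: (WLT_le1 act hq0 hq1 (VS_star_mul0 (qsphere_relations hA)) (az 0)).
have nle0 : ~ WLT_le alpha 0.
  have [f hf fz] := qsphere_circle_hom hk hA.
  apply: (not_WLT_le0 hf) => a.
  have ha := star_action_hom act (1%R : 'Z_2).
  have hs := @bc_shift_hom R pi.
  (* Equivariance is checked on generators only: both composites are unital star-homomorphisms, and
     these are determined by their values there. *)
  apply: (qsphere_hom_unique hA (unital_star_hom_comp ha hf) (unital_star_hom_comp hf hs)) => i /=.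
  rewrite az (star_homN hf) fz /circle_point; case: ifP => _.
    by rewrite bc_shift_pi_expi.
  by rewrite (star_hom0 hs) oppr0.
rewrite /dim_WLT; case: pselect => [ex|[]]; last by exists 1%N; apply/asboolP.
case: ex_minnP => m /asboolP hm min.
have : (m <= 1)%N by apply: min; apply/asboolP.
by case: m hm {min} => [|[|]].
Qed.
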